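(* Consider two Sasakian structures given in local coordinates $(r,u,v)$ and $(\tilde r,\tilde u,\tilde v)$ by $$ds^2=\left[dr+F\,du\right]^2+\frac{1}{2P_0^2}\left[du^2+dv^2\right],\qquad \alpha=dr+F\,du,\qquad \frac{\partial F}{\partial v}=\frac{1}{P_0^2},$$ $$d\tilde s^2=\left[d\tilde r+\tilde F\,d\tilde u\right]^2+\frac{1}{2\tilde P_0^2}\left[d\tilde u^2+d\tilde v^2\right],\qquad \tilde\alpha=d\tilde r+\tilde F\,d\tilde u,\qquad \frac{\partial \tilde F}{\partial \tilde v}=\frac{1}{\tilde P_0^2},$$ where $P_0,F$ are smooth real functions of $(u,v)$, $\tilde P_0,\tilde F$ are smooth real functions of $(\tilde u,\tilde v)$, and $P_0,\tilde P_0$ are nowhere zero. Put $z=u+iv$ and $w=\tilde u+i\tilde v$. Then the two structures are (locally) contact isometric if and only if there is a complex analytic function $z=z(w)$ such that $$\tilde P_0^2\left(\frac{dz}{dw}\right)\overline{\left(\frac{dz}{dw}\right)}=P_0^2,$$ where $\tilde P_0$ is evaluated at $w$ and $P_0$ at $z(w)$.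
   Context: Two smooth Riemannian manifolds $(M_1,g_1)$ and $(M_2,g_2)$ with contact structures given by contact 1-forms $\alpha_1$ and $\alpha_2$ are contact isometric if there exists a diffeomorphism $\phi:M_1\to M_2$ with $\phi^*g_2=g_1$ and $\phi^*\alpha_2=\alpha_1$. The statement is local: for points $p$ and $\tilde p$ in the two coordinate domains, ''contact isometric'' means that there is a contact isometry between some neighbourhoods of $p$ and $\tilde p$ matching these points, and the analytic function $z(w)$ is defined near $w(\tilde p)$ with $z(w(\tilde p))=z(p)$. The contact 1-form of each Sasakian structure is the 1-form metrically dual to its unit Killing field, $\frac{\partial}{\partial r}$ respectively $\frac{\partial}{\partial \tilde r}$. *)

(* Defs.v *)
From Stdlib Require Export Reals.
From Coquelicot Require Export Coquelicot.
Open Scope R_scope.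

(* Calculus on open subsets of a finite-dimensional real space [V]. *)

Definition dir_deriv {V : NormedModule R_AbsRing} (f : V -> R) (x h : V) : R :=
  Derive (fun t : R => f (plus x (scal t h))) 0.

Fixpoint Ck_on {V : NormedModule R_AbsRing} (k : nat) (U : V -> Prop)
    (f : V -> R) : Prop :=
  (forall x, U x -> continuous f x) /\
  match k with
  | O => True
  | S k' =>
      (forall x h, U x -> ex_derive (fun t : R => f (plus x (scal t h))) 0) /\
      (forall h, Ck_on k' U (fun x => dir_deriv f x h))
  end.

(* Since [V] is finite-dimensional in every use below, existence and continuity
   of all iterated directional derivatives is smoothness in the usual sense.
   Only the values of [f] on the open set [U] matter. *)
Definition smooth_on {V : NormedModule R_AbsRing} (U : V -> Prop) (f : V -> R)
    : Prop :=
  forall k, Ck_on k U f.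

(* Coordinate space of the (r,u,v), stored as (r, u + iv): a complex number of
   Coquelicot is the pair of its real and imaginary parts. Tangent vectors are
   also elements of [R3], so [rc], [uc], [vc] serve both as the coordinate
   functions and as the 1-forms dr, du, dv. *)
Definition R3 : NormedModule R_AbsRing :=
  prod_NormedModule R_AbsRing R_NormedModule C_R_NormedModule.

Definition rc (x : R3) : R := fst x.
Definition zc (x : R3) : C := snd x.
Definition uc (x : R3) : R := Re (zc x).
Definition vc (x : R3) : R := Im (zc x).

Definition smooth_map_on (U : R3 -> Prop) (phi : R3 -> R3) : Prop :=
  smooth_on U (fun x => rc (phi x)) /\
  smooth_on U (fun x => uc (phi x)) /\
  smooth_on U (fun x => vc (phi x)).

Definition differential (phi : R3 -> R3) (x h : R3) : R3 :=
  (dir_deriv (fun y => rc (phi y)) x h,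
    (dir_deriv (fun y => uc (phi y)) x h,
     dir_deriv (fun y => vc (phi y)) x h)).

Definition diffeomorphism (N N' : R3 -> Prop) (phi : R3 -> R3) : Prop :=
  exists psi : R3 -> R3,
    (forall x, N x -> N' (phi x) /\ psi (phi x) = x) /\
    (forall y, N' y -> N (psi y) /\ phi (psi y) = y) /\
    smooth_map_on N phi /\ smooth_map_on N' psi.

(* A coordinate domain with a metric and a 1-form: [metric x h k] is g_x(h,k)
   and [form x h] is alpha_x(h). *)
Record contact_chart := ContactChart {
  domain : R3 -> Prop;
  metric : R3 -> R3 -> R3 -> R;
  form : R3 -> R3 -> R
}.

Definition pullback_metric (phi : R3 -> R3) (g : R3 -> R3 -> R3 -> R)
    (x h k : R3) : R :=
  g (phi x) (differential phi x h) (differential phi x k).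

Definition pullback_form (phi : R3 -> R3) (a : R3 -> R3 -> R) (x h : R3) : R :=
  a (phi x) (differential phi x h).

Definition contact_isometry (M1 M2 : contact_chart) (N1 N2 : R3 -> Prop)
    (phi : R3 -> R3) : Prop :=
  diffeomorphism N1 N2 phi /\
  (forall x h k, N1 x -> pullback_metric phi (metric M2) x h k = metric M1 x h k) /\
  (forall x h, N1 x -> pullback_form phi (form M2) x h = form M1 x h).

Definition locally_contact_isometric (M1 M2 : contact_chart) (p1 p2 : R3)
    : Prop :=
  exists (N1 N2 : R3 -> Prop) (phi : R3 -> R3),
    open N1 /\ open N2 /\ N1 p1 /\ N2 p2 /\
    (forall x, N1 x -> domain M1 x) /\ (forall y, N2 y -> domain M2 y) /\
    phi p1 = p2 /\ contact_isometry M1 M2 N1 N2 phi.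

(* The set of all z = u + iv occurring in [U]: functions of (u,v) live here. *)
Definition base (U : R3 -> Prop) (z : C) : Prop :=
  exists x : R3, U x /\ zc x = z.

Definition sasakian_form (F : C -> R) (x h : R3) : R :=
  rc h + F (zc x) * uc h.

Definition sasakian_metric (P0 F : C -> R) (x h k : R3) : R :=
  sasakian_form F x h * sasakian_form F x k
  + 1 / (2 * P0 (zc x) ^ 2) * (uc h * uc k + vc h * vc k).

Definition sasakian_chart (U : R3 -> Prop) (P0 F : C -> R) : contact_chart :=
  ContactChart U (sasakian_metric P0 F) (sasakian_form F).

Definition sasakian_data (U : R3 -> Prop) (P0 F : C -> R) : Prop :=
  open U /\
  smooth_on (V := C_R_NormedModule) (base U) P0 /\
  smooth_on (V := C_R_NormedModule) (base U) F /\
  (forall z, base U z -> P0 z <> 0) /\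
  (forall u v, base U (u, v) ->
     is_derive (fun t : R => F (u, t)) v (1 / P0 (u, v) ^ 2)).

(* Analytic = locally the sum of a convergent complex power series. *)
Definition analytic_on (W : C -> Prop) (f : C -> C) : Prop :=
  forall w0 : C, W w0 ->
    exists a : nat -> C,
      locally w0 (fun w : C =>
        is_pseries (K := C_AbsRing) (V := C_NormedModule) a (w - w0)%C (f w)).

Definition complex_deriv (f : C -> C) (w d : C) : Prop :=
  is_derive (K := C_AbsRing) (V := C_NormedModule) f w d.

(* Main.v *)
Require Import Defs.
From Stdlib Require Import Lra Lia Psatz.

(* A contact isometry (r, z) |-> (r~, w) preserves the contact form, hence (by
   the metric) the horizontal part of the metric, and restricted to a slice
   r = const it gives a map z |-> w that is conformal. Taking the exterior
   derivative of  dr~ + F~ du~ = dr + F du  gives equality of the area forms, so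
   the map preserves orientation: it satisfies the Cauchy-Riemann equations, and
   its local inverse z(w) is holomorphic of class C^1, hence analytic by Cauchy's
   formula. Conversely, given z(w), the 1-form  F~ du~ - F du  pulled back to the
   w-plane is closed because  P~^2 |dz/dw|^2 = P^2;  a primitive f of it yields
   the contact isometry  (r~, w) |-> (r~ + f(w), z(w)). *)

(** The slice taken is the one through [p]: it already maps onto an open set of w, so the dependence
    of w on r is never asked for. The metric by itself would also admit antiholomorphic maps. The
    condition dF/dv = 1/P0^2 makes d(alpha) the same constant multiple of the horizontal area form
    in both structures, and this excludes them.

    The main obstacle is the distance between real directional derivatives, which is all that an
    isometry supplies, and the power series demanded of z(w). Holomorphic functions are therefore
    carried together with a continuous derivative. For these, Cauchy's formula follows by
    differentiating under the integral sign, without contours or homotopies, and a Newton iteration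
    gives a local inverse of the same class. Both directions use this: one to obtain z(w) from the
    isometry, the other to see that the inverse of z(w) is analytic too, hence that the isometry
    built from it is a smooth diffeomorphism. *)

Local Notation R2 := (prod_NormedModule R_AbsRing R_NormedModule R_NormedModule).
Local Notation is_Cseries := (is_series (K := C_AbsRing) (V := C_NormedModule)).
Local Notation Ccontinuous f x := (continuous (U := C_UniformSpace) f x).

(** * Iterated directional derivatives *)

(* [filter_imp] without the instance search, which fails on [C_R_NormedModule]. *)
Lemma locally_mono {T : UniformSpace} (P Q : T -> Prop) (x : T) :
  (forall y, P y -> Q y) -> locally x P -> locally x Q.
Proof. apply filter_imp. Qed.

Lemma continuous_line {V : NormedModule R_AbsRing} (x h : V) (t : R) :
  continuous (fun s : R => plus x (scal s h)) t.
Proof.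
  apply (continuous_plus (fun _ : R => x) (fun s : R => scal s h)).
  - apply continuous_const.
  - apply (continuous_scal_l (fun s : R => s) h t), continuous_id.
Qed.

Lemma line_at_0 {V : NormedModule R_AbsRing} (x h : V) :
  plus x (scal (0 : R) h) = x.
Proof.
  rewrite (scal_zero_l h : scal (0 : R) h = zero). apply plus_zero_r.
Qed.

Lemma line_shift {V : NormedModule R_AbsRing} (x h : V) (s t : R) :
  plus (plus x (scal s h)) (scal t h) = plus x (scal (t + s) h).
Proof.
  rewrite (scal_distr_r t s h : scal (t + s) h = plus (scal t h) (scal s h)).
  now rewrite <- plus_assoc, (plus_comm (scal s h)).
Qed.

Lemma locally_line {V : NormedModule R_AbsRing} (U : V -> Prop) (x h : V) (t : R) :
  open U -> U (plus x (scal t h)) ->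
  locally t (fun s : R => U (plus x (scal s h))).
Proof.
  intros HU Hx. apply (continuous_line x h t). now apply HU.
Qed.

(** [dir_deriv] differentiates at parameter 0 only. Moving the base point along the line turns it
    into a derivative at every parameter, as theorems on partial derivatives require. *)
Lemma is_derive_line {V : NormedModule R_AbsRing} (f : V -> R) (x h : V) (t : R) :
  ex_derive (fun s : R => f (plus (plus x (scal t h)) (scal s h))) 0 ->
  is_derive (fun s : R => f (plus x (scal s h))) t
    (dir_deriv f (plus x (scal t h)) h).
Proof.
  intros H. apply Derive_correct in H. unfold dir_deriv.
  apply (is_derive_ext (fun s : R => f (plus (plus x (scal t h)) (scal (s - t) h)))).
  { intros s. rewrite line_shift. assert (E : s - t + t = s :> R) by ring. now rewrite E. }
  rewrite <- (Rmult_1_l (Derive _ 0)).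
  apply (is_derive_comp (fun s : R => f (plus (plus x (scal t h)) (scal s h)))
           (fun s => s - t)).
  - now replace (t - t) with 0 by ring.
  - auto_derive; trivial.
Qed.

(** * Closure properties of the classes [Ck_on] *)

Section Smooth.
Context {V : NormedModule R_AbsRing}.
Implicit Types (U : V -> Prop) (f g : V -> R) (k : nat).

Lemma Ck_on_continuous k U f x : Ck_on k U f -> U x -> continuous f x.
Proof. destruct k; intros [H _]; auto. Qed.

Lemma Ck_on_S k U f : Ck_on (S k) U f -> Ck_on k U f.
Proof.
  revert f; induction k; intros f [Hc [Hd Hk]]; repeat split; auto.
Qed.

Lemma Ck_on_sub k U U' f :
  (forall x, U' x -> U x) -> Ck_on k U f -> Ck_on k U' f.
Proof.
  intros HU; revert f; induction k; intros f [Hc Hk]; split; auto.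
  destruct Hk; split; auto.
Qed.

(** The clauses of [Ck_on] are tested point by point, and [dir_deriv] does not mention the set.
    Through this lemma local power series yield smoothness on a whole open set. *)
Lemma Ck_on_local k U f :
  (forall x, U x -> exists U', U' x /\ Ck_on k U' f) -> Ck_on k U f.
Proof.
  revert f; induction k; intros f H; split; auto.
  - intros x Hx. destruct (H x Hx) as [U' [Hx' Hf]]. now apply (Ck_on_continuous 0 U').
  - intros x Hx. destruct (H x Hx) as [U' [Hx' Hf]]. now apply (Ck_on_continuous (S k) U').
  - split.
    + intros x h Hx. destruct (H x Hx) as [U' [Hx' [_ [Hf _]]]]. auto.
    + intros h. apply IHk. intros x Hx.
      destruct (H x Hx) as [U' [Hx' [_ [_ Hf]]]]. eauto.
Qed.

Lemma dir_deriv_ext_on U f g x h :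
  open U -> (forall y, U y -> f y = g y) -> U x ->
  dir_deriv f x h = dir_deriv g x h.
Proof.
  intros HU Hfg Hx. apply Derive_ext_loc.
  apply (filter_imp (fun s : R => U (plus x (scal s h)))); auto.
  apply locally_line; auto. now rewrite line_at_0.
Qed.

Lemma Ck_on_ext k U f g :
  open U -> (forall y, U y -> f y = g y) -> Ck_on k U f -> Ck_on k U g.
Proof.
  intros HU; revert f g; induction k; intros f g Hfg [Hc Hk];
  (split; [ intros x Hx; apply (continuous_ext_loc _ f); auto;
            apply (filter_imp U); auto | auto ]).
  destruct Hk as [Hd Hk]; split.
  - intros x h Hx.
    apply (ex_derive_ext_loc (fun t : R => f (plus x (scal t h)))); auto.
    apply (filter_imp (fun s : R => U (plus x (scal s h)))); auto.
    apply locally_line; auto. now rewrite line_at_0.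
  - intros h. apply (IHk (fun x => dir_deriv f x h)); auto.
    intros y Hy. now apply (dir_deriv_ext_on U).
Qed.

(** A derivative is usually known by a formula valid on [U] only; extensionality over the open set
    carries that formula through all higher orders. The closure proofs below go through this
    lemma. *)
Lemma Ck_on_intro k U f (df : V -> V -> R) :
  open U -> (forall x, U x -> continuous f x) ->
  (forall x h, U x -> is_derive (fun t : R => f (plus x (scal t h))) 0 (df x h)) ->
  (forall h, Ck_on k U (fun x => df x h)) ->
  Ck_on (S k) U f.
Proof.
  intros HU Hc Hd Hk. split; [auto|split].
  - intros x h Hx. eexists; eauto.
  - intros h. apply (Ck_on_ext k U (fun x => df x h)); auto.
    intros y Hy. symmetry. now apply is_derive_unique, Hd.
Qed.

Lemma Ck_on_is_derive k U f x h :
  Ck_on (S k) U f -> U x ->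
  is_derive (fun t : R => f (plus x (scal t h))) 0 (dir_deriv f x h).
Proof. intros [_ [Hd _]] Hx. now apply Derive_correct, Hd. Qed.

Lemma Ck_on_const k U (c : R) : open U -> Ck_on k U (fun _ => c).
Proof.
  intros HU; revert c; induction k; intros c.
  - split; auto. intros; apply continuous_const.
  - apply (Ck_on_intro k U _ (fun _ _ => 0)); auto.
    + intros; apply continuous_const.
    + intros. apply (is_derive_const (K := R_AbsRing) (V := R_NormedModule)).
Qed.

Lemma Ck_on_plus k U f g :
  open U -> Ck_on k U f -> Ck_on k U g -> Ck_on k U (fun x => f x + g x).
Proof.
  intros HU; revert f g; induction k; intros f g Hf Hg.
  - split; auto. intros x Hx. apply (continuous_plus f g); eapply Ck_on_continuous; eauto.
  - apply (Ck_on_intro k U _ (fun x h => dir_deriv f x h + dir_deriv g x h)); auto.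
    + intros x Hx. apply (continuous_plus f g); eapply Ck_on_continuous; eauto.
    + intros x h Hx.
      apply (is_derive_plus (fun t : R => f (plus x (scal t h)))
               (fun t : R => g (plus x (scal t h))));
      eapply Ck_on_is_derive; eauto.
    + intros h. apply IHk; [apply Hf|apply Hg].
Qed.

Lemma Ck_on_mult k U f g :
  open U -> Ck_on k U f -> Ck_on k U g -> Ck_on k U (fun x => f x * g x).
Proof.
  intros HU; revert f g; induction k; intros f g Hf Hg.
  - split; auto. intros x Hx.
    apply (continuous_mult f g); eapply Ck_on_continuous; eauto.
  - apply (Ck_on_intro k U _ (fun x h => dir_deriv f x h * g x + f x * dir_deriv g x h)); auto.
    + intros x Hx. apply (continuous_mult f g); eapply Ck_on_continuous; eauto.
    + intros x h Hx.
      generalize (is_derive_mult (fun t : R => f (plus x (scal t h)))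
               (fun t : R => g (plus x (scal t h))) 0 _ _
               (Ck_on_is_derive _ _ _ x h Hf Hx) (Ck_on_is_derive _ _ _ x h Hg Hx)
               Rmult_comm).
      now rewrite line_at_0.
    + intros h. apply Ck_on_plus; auto; apply IHk;
        try (now apply Ck_on_S); [apply Hf|apply Hg].
Qed.

Lemma Ck_on_linear k U (l : V -> R) :
  open U -> (forall x, continuous l x) ->
  (forall x h (t : R), l (plus x (scal t h)) = l x + t * l h) -> Ck_on k U l.
Proof.
  intros HU Hc Hl. destruct k.
  - split; auto.
  - apply (Ck_on_intro k U l (fun _ h => l h)); auto.
    + intros x h _. apply (is_derive_ext (fun t => l x + t * l h)).
      * intros t. now rewrite Hl.
      * auto_derive; trivial. ring.
    + intros h. now apply Ck_on_const.
Qed.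

End Smooth.

(** * The chain rule for functions of two real variables *)

Lemma C1_filterdiff (U : C_R_NormedModule -> Prop) (f : C_R_NormedModule -> R)
    (z : C_R_NormedModule) :
  open U -> Ck_on 1 U f -> U z ->
  filterdiff (U := R2)
    (V := R_NormedModule) f (locally z)
    (fun h => fst h * dir_deriv f z (1, 0) + snd h * dir_deriv f z (0, 1)).
Proof.
  intros HU Hf Hz. destruct z as [a b].
  assert (Hline : forall u v s t : R,
    plus ((u, v) : C_R_NormedModule) (scal s ((t, 0) : C_R_NormedModule))
    = (u + s * t, v)).
  { intros. apply injective_projections; simpl; unfold plus, scal; simpl; unfold mult; simpl; ring. }
  assert (Hline' : forall u v s t : R,
    plus ((u, v) : C_R_NormedModule) (scal s ((0, t) : C_R_NormedModule))
    = (u, v + s * t)).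
  { intros. apply injective_projections; simpl; unfold plus, scal; simpl; unfold mult; simpl; ring. }
  (* This criterion asks for the first partial derivative near the point, continuous there, and for
     the second one at the point. [R2] and [C_R_NormedModule] are convertible. *)
  generalize (is_derive_filterdiff (fun u v => f (u, v)) a b
    (fun u v => dir_deriv f ((u, v) : C_R_NormedModule) (1, 0))
    (dir_deriv f ((a, b) : C_R_NormedModule) (0, 1))).
  intros H.
  refine (filterdiff_ext_lin (FF := @filter_filter _ _ (locally_filter _)) _ _ _
    (filterdiff_ext (FF := @filter_filter _ _ (locally_filter _)) _ f _
       (fun p => f_equal f (eq_sym (surjective_pairing p))) (H _ _ _)) _).
  - apply (locally_mono (T := C_R_NormedModule) U); [|now apply HU]. intros [u v] Huv.
    (* The horizontal line is started at (0, v), so that its parameter is the coordinate [u]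
       itself. *)
    generalize (is_derive_line f ((0, v) : C_R_NormedModule) ((1, 0) : C_R_NormedModule) u).
    rewrite Hline. intros H1.
    replace (0 + u * 1) with u in H1 by ring.
    apply (is_derive_ext (fun s : R => f (plus ((0, v) : C_R_NormedModule)
      (scal s ((1, 0) : C_R_NormedModule))))).
    + intros t. rewrite Hline. simpl. f_equal. f_equal. ring.
    + apply H1. apply Hf; auto.
  - generalize (is_derive_line f ((a, 0) : C_R_NormedModule) ((0, 1) : C_R_NormedModule) b).
    rewrite Hline'. intros H1.
    replace (0 + b * 1) with b in H1 by ring.
    apply (is_derive_ext (fun s : R => f (plus ((a, 0) : C_R_NormedModule)
      (scal s ((0, 1) : C_R_NormedModule))))).
    + intros t. rewrite Hline'. simpl. f_equal. f_equal. ring.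
    + apply H1. apply Hf; auto.
  - destruct Hf as [_ [_ Hf]]. destruct (Hf (1, 0)) as [Hc _].
    apply (continuous_ext (fun u : C_R_NormedModule => dir_deriv f u (1, 0))).
    + now intros [u v].
    + now apply (Hc (a, b)).
  - intros [u v]. simpl. unfold plus, scal; simpl. unfold mult; simpl. ring.
Qed.

Lemma is_derive_comp_C1 (U : C_R_NormedModule -> Prop) (f : C_R_NormedModule -> R)
    (x y : R -> R) (t dx dy : R) :
  open U -> Ck_on 1 U f -> U (x t, y t) -> is_derive x t dx -> is_derive y t dy ->
  is_derive (fun s => f (x s, y s)) t
    (dx * dir_deriv f ((x t, y t) : C_R_NormedModule) (1, 0)
     + dy * dir_deriv f ((x t, y t) : C_R_NormedModule) (0, 1)).
Proof.
  intros HU Hf Ht Hx Hy.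
  generalize (filterdiff_comp'_2 x y (fun u v => f (u, v)) t _ _
    (fun u v => u * dir_deriv f ((x t, y t) : C_R_NormedModule) (1, 0)
              + v * dir_deriv f ((x t, y t) : C_R_NormedModule) (0, 1)) Hx Hy).
  intros H. eapply filterdiff_ext_lin; [apply H|].
  - apply (filterdiff_ext (FF := @filter_filter _ _ (locally_filter _)) f _ _
       (fun p => f_equal f (surjective_pairing p))).
    apply (C1_filterdiff U f (x t, y t) HU Hf Ht).
  - intros s. unfold scal; simpl; unfold mult; simpl. ring.
Qed.

(** Linearity in the direction is not built into [dir_deriv]; for a C^1 function it comes from the
    chain rule along the line. *)
Lemma dir_deriv_partials (U : C_R_NormedModule -> Prop) (f : C_R_NormedModule -> R)
    (z h : C_R_NormedModule) :
  open U -> Ck_on 1 U f -> U z ->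
  dir_deriv f z h = fst h * dir_deriv f z (1, 0) + snd h * dir_deriv f z (0, 1).
Proof.
  intros HU Hf Hz. destruct z as [a b], h as [c d].
  assert (Hlin : forall p q : R, is_derive (fun t : R => p + t * q) 0 q).
  { intros p q. auto_derive; trivial. ring. }
  generalize (is_derive_comp_C1 U f (fun t => a + t * c) (fun t => b + t * d) 0 c d HU Hf).
  rewrite !Rmult_0_l, !Rplus_0_r. intros H.
  apply is_derive_unique. apply H; auto.
Qed.

(** Differentiating the composite produces composites of the partial derivatives of [g] with the
    same [x] and [y]. The induction therefore generalises [g] alone. *)
Lemma Ck_on_comp {V : NormedModule R_AbsRing} (k : nat) (U : V -> Prop)
    (D : C_R_NormedModule -> Prop) (g : C_R_NormedModule -> R) (x y : V -> R) :
  open U -> open D -> (forall p, U p -> D (x p, y p)) ->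
  Ck_on k D g -> Ck_on k U x -> Ck_on k U y ->
  Ck_on k U (fun p => g (x p, y p)).
Proof.
  intros HU HD HUD; revert g; induction k; intros g Hg Hx Hy.
  1: split; auto.
  2: apply (Ck_on_intro k U _ (fun p h =>
       dir_deriv x p h * dir_deriv g (x p, y p) (1, 0)
       + dir_deriv y p h * dir_deriv g (x p, y p) (0, 1))); auto.
  1, 2: intros p Hp;
    apply (continuous_comp_2 x y (fun u v => g (u, v)));
    [ eapply Ck_on_continuous; eauto | eapply Ck_on_continuous; eauto |];
    apply (continuous_ext (T := C_R_NormedModule) g);
    [ now intros [u v] | eapply Ck_on_continuous; eauto].
  - intros p h Hp.
    assert (H1 : Ck_on 1 D g).
    { clear -Hg. induction k; auto. now apply IHk, Ck_on_S. }
    generalize (is_derive_comp_C1 D g (fun t => x (plus p (scal t h)))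
      (fun t => y (plus p (scal t h))) 0 (dir_deriv x p h) (dir_deriv y p h) HD H1).
    rewrite line_at_0. intros H. apply H; auto; eapply Ck_on_is_derive; eauto.
  - intros h. destruct Hx as [Hx0 [Hx1 Hx2]], Hy as [Hy0 [Hy1 Hy2]], Hg as [_ [_ Hg]].
    assert (Hx : Ck_on k U x) by (apply Ck_on_S; repeat split; auto).
    assert (Hy : Ck_on k U y) by (apply Ck_on_S; repeat split; auto).
    apply Ck_on_plus; auto; apply Ck_on_mult; auto.
    + apply (IHk (fun q => dir_deriv g q (1, 0))); auto.
    + apply (IHk (fun q => dir_deriv g q (0, 1))); auto.
Qed.

Lemma Ck_on_rc (k : nat) (U : R3 -> Prop) : open U -> Ck_on k U rc.
Proof.
  intros HU. apply Ck_on_linear; auto.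
  intros x. apply (continuous_fst (U := R_UniformSpace) (V := C_UniformSpace)).
Qed.

Lemma Ck_on_uc (k : nat) (U : R3 -> Prop) : open U -> Ck_on k U uc.
Proof.
  intros HU. apply Ck_on_linear; auto.
  intros x. apply (continuous_comp (U := R3) (snd : R3 -> C_UniformSpace) (fst : C_UniformSpace -> R)).
  - apply (continuous_snd (U := R_UniformSpace) (V := C_UniformSpace)).
  - apply (continuous_fst (U := R_UniformSpace) (V := R_UniformSpace)).
Qed.

Lemma Ck_on_vc (k : nat) (U : R3 -> Prop) : open U -> Ck_on k U vc.
Proof.
  intros HU. apply Ck_on_linear; auto.
  intros x. apply (continuous_comp (U := R3) (snd : R3 -> C_UniformSpace) (snd : C_UniformSpace -> R)).
  - apply (continuous_snd (U := R_UniformSpace) (V := C_UniformSpace)).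
  - apply (continuous_snd (U := R_UniformSpace) (V := R_UniformSpace)).
Qed.

(** * Complex differentiability *)

Lemma Cmod_le_abs (z : C) : Cmod z <= Rabs (Re z) + Rabs (Im z).
Proof.
  destruct z as [a b]. unfold Cmod; simpl.
  apply Rsqr_incr_0_var.
  - rewrite Rsqr_sqrt by nra. unfold Rsqr.
    generalize (Rabs_pos a) (Rabs_pos b).
    assert (a * a = Rabs a * Rabs a) by (rewrite <- Rabs_mult, Rabs_pos_eq; nra).
    assert (b * b = Rabs b * Rabs b) by (rewrite <- Rabs_mult, Rabs_pos_eq; nra).
    nra.
  - generalize (Rabs_pos a) (Rabs_pos b); lra.
Qed.

Lemma Re_le_Cmod (z : C) : Rabs (Re z) <= Cmod z.
Proof. eapply Rle_trans; [apply Rmax_l|apply Rmax_Cmod]. Qed.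

Lemma Im_le_Cmod (z : C) : Rabs (Im z) <= Cmod z.
Proof. eapply Rle_trans; [apply Rmax_r|apply Rmax_Cmod]. Qed.

Lemma norm_C_R (z : C) : norm (V := C_R_NormedModule) z = Cmod z.
Proof.
  destruct z as [a b]. unfold norm; simpl. unfold prod_norm, Cmod. simpl.
  unfold norm; simpl; unfold abs; simpl. f_equal.
  rewrite !Rmult_1_r, <- !Rabs_mult, !Rabs_pos_eq; nra.
Qed.

Lemma Ceta (z : C) : (Re z, Im z) = z.
Proof. now destruct z. Qed.

Lemma locally_Cmod (w : C) (P : C -> Prop) :
  locally (T := C_UniformSpace) w P <->
  exists d : posreal, forall v, Cmod (v - w) < d -> P v.
Proof. apply locally_C. Qed.

Lemma open_disk (w : C) (r : R) :
  open (T := C_UniformSpace) (fun v => Cmod (v - w) < r).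
Proof.
  intros v Hv. apply locally_Cmod.
  assert (Hd : 0 < r - Cmod (v - w)) by lra.
  exists (mkposreal _ Hd). simpl. intros u Hu.
  replace (u - w)%C with ((u - v) + (v - w))%C by ring.
  eapply Rle_lt_trans; [apply Cmod_triangle|lra].
Qed.

Lemma continuous_Cmod (f : C -> C) (w : C) :
  continuous (T := C_UniformSpace) (U := C_UniformSpace) f w <->
  forall eps : posreal, exists d : posreal,
    forall v, Cmod (v - w) < d -> Cmod (f v - f w) < eps.
Proof.
  split.
  - intros H eps. apply locally_Cmod. apply (H (fun y => Cmod (y - f w) < eps)).
    apply locally_Cmod. now exists eps.
  - intros H P HP. apply locally_Cmod in HP. destruct HP as [eps HP].
    apply locally_Cmod. destruct (H eps) as [d Hd]. exists d. intros v Hv.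
    now apply HP, Hd.
Qed.

Lemma continuous_Re {T : UniformSpace} (f : T -> C) (w : T) :
  continuous (U := C_UniformSpace) f w -> continuous (fun v => Re (f v)) w.
Proof.
  intros H. apply (continuous_comp (V := C_UniformSpace) f (fst : C -> R)); auto.
  apply (continuous_fst (U := R_UniformSpace) (V := R_UniformSpace)).
Qed.

Lemma continuous_Im {T : UniformSpace} (f : T -> C) (w : T) :
  continuous (U := C_UniformSpace) f w -> continuous (fun v => Im (f v)) w.
Proof.
  intros H. apply (continuous_comp (V := C_UniformSpace) f (snd : C -> R)); auto.
  apply (continuous_snd (U := R_UniformSpace) (V := R_UniformSpace)).
Qed.

Lemma continuous_C_pair {T : UniformSpace} (f : T -> C) (x : T) :
  continuous (fun v => Re (f v)) x -> continuous (fun v => Im (f v)) x ->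
  continuous (U := C_UniformSpace) f x.
Proof.
  intros H1 H2.
  apply (continuous_ext (fun v => (Re (f v), Im (f v)) : C_UniformSpace)).
  - intros; apply Ceta.
  - unfold continuous. rewrite <- (Ceta (f x)).
    apply (filterlim_filter_le_2 (G := filter_prod (locally (Re (f x))) (locally (Im (f x))))).
    + intros P [eps HP]. exists (ball (Re (f x)) eps) (ball (Im (f x)) eps).
      * apply locally_ball.
      * apply locally_ball.
      * intros u v Hu Hv. apply HP. now split.
    + now apply filterlim_pair.
Qed.

(** Real and complex derivatives live in different normed modules, with [Cmod] as common norm. This
    form and [filterdiff_R2_iff] are the shared language in which they are compared. *)
Lemma complex_deriv_iff (f : C -> C) (w d : C) :
  complex_deriv f w d <->
  forall eps : posreal, exists del : posreal, forall v,
    Cmod (v - w) < del -> Cmod (f v - f w - d * (v - w)) <= eps * Cmod (v - w).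
Proof.
  split.
  - intros [_ H] eps.
    assert (Hl : is_filter_lim (locally (T := AbsRing_UniformSpace C_AbsRing) w) w) by (intros P HP; exact HP).
    destruct (H w Hl eps) as [del Hdel]. exists del. intros v Hv.
    rewrite (Cmult_comm d). exact (Hdel v Hv).
  - intros H. split.
    + apply is_linear_scal_l.
    + intros x Hx eps.
      apply (is_filter_lim_locally_unique (V := AbsRing_NormedModule C_AbsRing)) in Hx. subst x.
      destruct (H eps) as [del Hdel]. exists del. intros v Hv.
      generalize (Hdel v Hv). rewrite (Cmult_comm d). intros H1; exact H1.
Qed.

Lemma complex_deriv_continuous (f : C -> C) (w d : C) :
  complex_deriv f w d ->
  continuous (T := C_UniformSpace) (U := C_UniformSpace) f w.
Proof.
  intros H. rewrite complex_deriv_iff in H. apply continuous_Cmod. intros eps.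
  destruct (H (mkposreal 1 Rlt_0_1)) as [del Hdel]; simpl in Hdel.
  assert (Hm : 0 < Rmin del (eps / (1 + Cmod d))).
  { apply Rmin_glb_lt; [apply cond_pos|].
    apply Rdiv_lt_0_compat; [apply cond_pos|generalize (Cmod_ge_0 d); lra]. }
  exists (mkposreal _ Hm). simpl. intros v Hv.
  assert (H1 : Cmod (v - w) < del) by (eapply Rlt_le_trans; [apply Hv|apply Rmin_l]).
  assert (H2 : Cmod (v - w) < eps / (1 + Cmod d)) by (eapply Rlt_le_trans; [apply Hv|apply Rmin_r]).
  specialize (Hdel v H1).
  replace (f v - f w)%C with ((f v - f w - d * (v - w)) + d * (v - w))%C by ring.
  eapply Rle_lt_trans; [apply Cmod_triangle|]. rewrite Cmod_mult.
  apply (Rmult_lt_compat_r (1 + Cmod d)) in H2; [|generalize (Cmod_ge_0 d); lra].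
  unfold Rdiv in H2. rewrite Rmult_assoc, Rinv_l in H2 by (generalize (Cmod_ge_0 d); lra).
  lra.
Qed.

Lemma filterdiff_R2_iff (g : C -> R) (w : C) (a b : R) :
  filterdiff (U := R2) (V := R_NormedModule) g (locally w)
    (fun h => fst h * a + snd h * b) <->
  forall eps : posreal, exists del : posreal, forall v,
    Cmod (v - w) < del ->
    Rabs (g v - g w - (Re (v - w) * a + Im (v - w) * b)) <= eps * Cmod (v - w).
Proof.
  split.
  - intros [_ H] eps.
    assert (Hl : is_filter_lim (locally (T := R2) w) w) by (intros P HP; exact HP).
    specialize (H w Hl eps). apply locally_Cmod in H. destruct H as [del Hdel].
    exists del. intros v Hv. generalize (Hdel v Hv).
    rewrite <- norm_C_R. intros H1; exact H1.
  - intros H. split.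
    + split.
      * intros [x1 y1] [x2 y2]. simpl. unfold plus; simpl. ring.
      * intros k [x y]. simpl. unfold scal; simpl. unfold mult; simpl. ring.
      * exists (Rabs a + Rabs b + 1). split.
        { generalize (Rabs_pos a) (Rabs_pos b); lra. }
        intros h.
        assert (E : norm (K := R_AbsRing) (V := R2) h = Cmod h) by apply norm_C_R.
        rewrite E.
        change (Rabs (fst h * a + snd h * b) <= (Rabs a + Rabs b + 1) * Cmod h).
        eapply Rle_trans; [apply Rabs_triang|]. rewrite !Rabs_mult.
        apply Rle_trans with (Cmod h * Rabs a + Cmod h * Rabs b).
        { apply Rplus_le_compat; apply Rmult_le_compat_r; try apply Rabs_pos;
          [apply Re_le_Cmod|apply Im_le_Cmod]. }
        generalize (Cmod_ge_0 h). simpl. lra.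
    + intros x Hx eps.
      apply (is_filter_lim_locally_unique (V := R2)) in Hx. subst x.
      apply locally_Cmod. destruct (H eps) as [del Hdel]. exists del. intros v Hv.
      generalize (Hdel v Hv). rewrite <- norm_C_R. intros H1; exact H1.
Qed.

(** As a real linear map, multiplication by [d] has the rows (Re d, - Im d) and (Im d, Re d): these
    are the Cauchy-Riemann equations. *)
Lemma complex_deriv_filterdiff (f : C -> C) (w d : C) :
  complex_deriv f w d <->
  (filterdiff (U := R2) (V := R_NormedModule) (fun v => Re (f v)) (locally w)
    (fun h => fst h * Re d + snd h * - Im d) /\
  filterdiff (U := R2) (V := R_NormedModule) (fun v => Im (f v)) (locally w)
    (fun h => fst h * Im d + snd h * Re d)).
Proof.
  rewrite !filterdiff_R2_iff, complex_deriv_iff.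
  assert (ERe : forall v, Re (f v) - Re (f w) - (Re (v - w) * Re d + Im (v - w) * - Im d)
    = Re (f v - f w - d * (v - w))%C).
  { intros v. destruct v, w, d, (f _), (f _). simpl. ring. }
  assert (EIm : forall v, Im (f v) - Im (f w) - (Re (v - w) * Im d + Im (v - w) * Re d)
    = Im (f v - f w - d * (v - w))%C).
  { intros v. destruct v, w, d, (f _), (f _). simpl. ring. }
  split.
  - intros H. split; intros eps; destruct (H eps) as [del Hdel]; exists del; intros v Hv.
    + rewrite ERe. eapply Rle_trans; [apply Re_le_Cmod|auto].
    + rewrite EIm. eapply Rle_trans; [apply Im_le_Cmod|auto].
  - intros [H1 H2] eps.
    assert (He : 0 < eps / 2) by (generalize (cond_pos eps); lra).
    destruct (H1 (mkposreal _ He)) as [d1 Hd1], (H2 (mkposreal _ He)) as [d2 Hd2].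
    cbn [pos] in Hd1, Hd2.
    assert (Hm : 0 < Rmin d1 d2) by (apply Rmin_glb_lt; apply cond_pos).
    exists (mkposreal _ Hm). cbn [pos]. intros v Hv.
    eapply Rle_trans; [apply Cmod_le_abs|].
    rewrite <- ERe, <- EIm.
    generalize (Hd1 v (Rlt_le_trans _ _ _ Hv (Rmin_l _ _)))
      (Hd2 v (Rlt_le_trans _ _ _ Hv (Rmin_r _ _))). lra.
Qed.

Lemma is_derive_comp_complex (f : C -> C) (x y : R -> R) (t dx dy : R) (d : C) :
  complex_deriv f (x t, y t) d -> is_derive x t dx -> is_derive y t dy ->
  is_derive (fun s => Re (f (x s, y s))) t (Re (d * (dx, dy))) /\
  is_derive (fun s => Im (f (x s, y s))) t (Im (d * (dx, dy))).
Proof.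
  intros Hf Hx Hy. apply complex_deriv_filterdiff in Hf. destruct Hf as [H1 H2].
  split.
  - generalize (filterdiff_comp'_2 x y (fun u v => Re (f (u, v))) t _ _
      (fun u v => u * Re d + v * - Im d) Hx Hy).
    intros H. eapply filterdiff_ext_lin; [apply H|].
    + apply (filterdiff_ext (U := R2) (V := R_NormedModule)
       (FF := @filter_filter _ _ (locally_filter _)) (fun v => Re (f v)) _ _ (fun p => f_equal (fun v => Re (f v)) (surjective_pairing p))).
      exact H1.
    + intros s. destruct d. unfold scal; simpl; unfold mult; simpl. ring.
  - generalize (filterdiff_comp'_2 x y (fun u v => Im (f (u, v))) t _ _
      (fun u v => u * Im d + v * Re d) Hx Hy).
    intros H. eapply filterdiff_ext_lin; [apply H|].
    + apply (filterdiff_ext (U := R2) (V := R_NormedModule)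
       (FF := @filter_filter _ _ (locally_filter _)) (fun v => Im (f v)) _ _ (fun p => f_equal (fun v => Im (f v)) (surjective_pairing p))).
      exact H2.
    + intros s. destruct d. unfold scal; simpl; unfold mult; simpl. ring.
Qed.

Lemma complex_deriv_line (f : C -> C) (z h d : C) :
  complex_deriv f z d ->
  is_derive (fun t : R => Re (f (plus (z : C_R_NormedModule) (scal t (h : C_R_NormedModule))))) 0 (Re (d * h)) /\
  is_derive (fun t : R => Im (f (plus (z : C_R_NormedModule) (scal t (h : C_R_NormedModule))))) 0 (Im (d * h)).
Proof.
  destruct z as [a b], h as [p q]. intros H.
  apply (is_derive_comp_complex f (fun t => a + t * p) (fun t => b + t * q)).
  - now rewrite !Rmult_0_l, !Rplus_0_r.
  - auto_derive; trivial. ring.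
  - auto_derive; trivial. ring.
Qed.

(** * Complex power series *)

Lemma sum_n_C (u : nat -> C) (n : nat) :
  sum_n (G := C_NormedModule) u n
  = (sum_n (fun k => Re (u k)) n, sum_n (fun k => Im (u k)) n).
Proof.
  induction n.
  - rewrite !sum_O. symmetry; apply Ceta.
  - rewrite !sum_Sn, IHn. reflexivity.
Qed.

Lemma is_series_C (u : nat -> C) (l : C) :
  is_Cseries u l <->
  is_series (fun n => Re (u n)) (Re l) /\ is_series (fun n => Im (u n)) (Im l).
Proof.
  split.
  - intros H. split.
    + apply filterlim_ext with (fun n => Re (sum_n (G := C_NormedModule) u n)).
      { intros n. now rewrite sum_n_C. }
      eapply filterlim_comp; [apply H|].
      apply (continuous_fst (U := R_UniformSpace) (V := R_UniformSpace)).
    + apply filterlim_ext with (fun n => Im (sum_n (G := C_NormedModule) u n)).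
      { intros n. now rewrite sum_n_C. }
      eapply filterlim_comp; [apply H|].
      apply (continuous_snd (U := R_UniformSpace) (V := R_UniformSpace)).
  - intros [H1 H2].
    apply filterlim_ext with
      (fun n => (sum_n (fun k => Re (u k)) n, sum_n (fun k => Im (u k)) n) : C).
    { intros n. now rewrite sum_n_C. }
    apply (filterlim_locally (U := C_UniformSpace)). intros eps.
    generalize (proj1 (filterlim_locally _ _) H1 eps)
      (proj1 (filterlim_locally _ _) H2 eps).
    intros E1 E2. generalize (filter_and _ _ E1 E2). apply filter_imp.
    intros n [G1 G2]. now split.
Qed.

Lemma is_series_C_unique (u : nat -> C) (l l' : C) :
  is_Cseries u l -> is_Cseries u l' -> l = l'.
Proof.
  rewrite !is_series_C. intros [H1 H2] [H3 H4].
  apply injective_projections.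
  - apply is_series_unique in H1, H3. unfold Re in *. congruence.
  - apply is_series_unique in H2, H4. unfold Im in *. congruence.
Qed.

(** Real and imaginary parts are estimated separately, whence the factor 2, which is harmless in the
    estimates below. *)
Lemma is_series_C_bound (u : nat -> C) (l : C) (v : nat -> R) :
  is_Cseries u l -> (forall n, Cmod (u n) <= v n) -> ex_series v ->
  Cmod l <= 2 * Series v.
Proof.
  intros H Hv Hex. apply is_series_C in H. destruct H as [H1 H2].
  assert (Hb : forall w : nat -> R, (forall n, Rabs (w n) <= v n) -> Rabs (Series w) <= Series v).
  { intros w Hw. eapply Rle_trans; [apply Series_Rabs|apply Series_le; auto].
    - apply (ex_series_le (V := R_CompleteNormedModule) _ v); auto.
      intros n. unfold norm; simpl; unfold abs; simpl. now rewrite Rabs_Rabsolu.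
    - intros n. split; auto. apply Rabs_pos. }
  eapply Rle_trans; [apply Cmod_le_abs|].
  rewrite <- (is_series_unique _ _ H1), <- (is_series_unique _ _ H2).
  assert (Rabs (Series (fun n => Re (u n))) <= Series v).
  { apply Hb. intros n. eapply Rle_trans; [apply Re_le_Cmod|auto]. }
  assert (Rabs (Series (fun n => Im (u n))) <= Series v).
  { apply Hb. intros n. eapply Rle_trans; [apply Im_le_Cmod|auto]. }
  lra.
Qed.

(** Total, through the total [Series]; it is the sum of the complex series only where that
    converges. *)
Definition Cpseries (a : nat -> C) (z : C) : C :=
  (Series (fun n => Re (a n * z ^ n)%C), Series (fun n => Im (a n * z ^ n)%C)).

(** Taking the moduli as coefficients makes the theory of real power series, such as the invariance
    of the radius under differentiation, available for complex ones. *)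
Definition Cradius (a : nat -> C) : Rbar := CV_radius (fun n => Cmod (a n)).

Definition Cderiv_coef (a : nat -> C) (n : nat) : C := (INR (S n) * a (S n))%C.

Lemma ex_series_Cmod (a : nat -> C) (r : R) :
  0 <= r -> Rbar_lt r (Cradius a) -> ex_series (fun n => Cmod (a n) * r ^ n).
Proof.
  intros Hr H. rewrite <- (Rabs_pos_eq r Hr) in H. apply CV_disk_inside in H.
  eapply ex_series_ext; [|apply H]. intros n. simpl.
  apply Rabs_pos_eq, Rmult_le_pos; [apply Cmod_ge_0|now apply pow_le].
Qed.

Lemma Cpseries_is_series (a : nat -> C) (z : C) :
  Rbar_lt (Cmod z) (Cradius a) ->
  is_Cseries (fun n => (a n * z ^ n)%C) (Cpseries a z).
Proof.
  intros H. apply ex_series_Cmod in H; [|apply Cmod_ge_0].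
  assert (Hm : forall n, Cmod (a n * z ^ n) = Cmod (a n) * Cmod z ^ n).
  { intros n. now rewrite Cmod_mult, Cmod_pow. }
  apply is_series_C. split; apply Series_correct;
  refine (ex_series_le (V := R_CompleteNormedModule) _ _ _ H); intros n;
  rewrite <- Hm; [apply Re_le_Cmod|apply Im_le_Cmod].
Qed.

Lemma pow_n_Cpow (z : C) (n : nat) : pow_n (K := C_Ring) z n = (z ^ n)%C.
Proof. induction n; [reflexivity|]. simpl. now rewrite IHn. Qed.

Lemma is_pseries_C (a : nat -> C) (z l : C) :
  is_pseries (K := C_AbsRing) (V := C_NormedModule) a z l <->
  is_Cseries (fun n => (a n * z ^ n)%C) l.
Proof.
  unfold is_pseries. split; apply is_series_ext; intros n; rewrite <- pow_n_Cpow;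
    apply Cmult_comm.
Qed.

Lemma Cradius_deriv (a : nat -> C) : Cradius (Cderiv_coef a) = Cradius a.
Proof.
  unfold Cradius. rewrite <- (CV_radius_derive (fun n => Cmod (a n))). apply CV_radius_ext. intros n.
  unfold Cderiv_coef, PS_derive. rewrite Cmod_mult, Cmod_R, Rabs_pos_eq; [easy|apply pos_INR].
Qed.

(** The weight n^2 comes from applying x d/dx twice, which preserves the radius of convergence. The
    series majorises the second-order Taylor remainder of a power series. *)
Lemma ex_series_Cmod_sqr (a : nat -> C) (r : R) :
  0 <= r -> Rbar_lt r (Cradius a) ->
  ex_series (fun n => Cmod (a n) * (INR n ^ 2 * r ^ n)).
Proof.
  intros Hr H.
  set (b := PS_incr_1 (PS_derive (PS_incr_1 (PS_derive (fun n => Cmod (a n)))))).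
  assert (Hb : CV_radius b = Cradius a).
  { unfold b. now rewrite CV_radius_incr_1, CV_radius_derive, CV_radius_incr_1, CV_radius_derive. }
  rewrite <- Hb, <- (Rabs_pos_eq r Hr) in H. apply CV_disk_inside in H.
  eapply ex_series_ext; [|apply H]. intros n.
  assert (E : b n = INR n ^ 2 * Cmod (a n)).
  { unfold b, PS_incr_1, PS_derive. destruct n; [simpl; unfold zero; simpl; ring|].
    change (INR (S n) * (INR (S n) * Cmod (a (S n))) = INR (S n) ^ 2 * Cmod (a (S n))).
    ring. }
  cbv beta. rewrite E, Rabs_pos_eq.
  - simpl. ring.
  - apply Rmult_le_pos; [|now apply pow_le].
    apply Rmult_le_pos; [|apply Cmod_ge_0]. apply pow_le, pos_INR.
Qed.

(* Multiplied by [r ^ 2], which avoids the exponent [n - 2]. *)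
Lemma Cpow_taylor_bound (z v : C) (r : R) (n : nat) :
  0 < r -> Cmod z <= r -> Cmod v <= r ->
  r ^ 2 * Cmod (v ^ n - z ^ n - match n with O => 0 | S m => INR (S m) * z ^ m end * (v - z))
  <= INR n ^ 2 * r ^ n * Cmod (v - z) ^ 2.
Proof.
  intros Hr Hz Hv.
  set (D := fun n : nat => match n with O => 0 | S m => (INR (S m) * z ^ m)%C end : C).
  change (r ^ 2 * Cmod (v ^ n - z ^ n - D n * (v - z)) <= INR n ^ 2 * r ^ n * Cmod (v - z) ^ 2).
  assert (HD : forall n, r ^ 2 * Cmod (D n) <= INR n * r ^ S n).
  { intros [|m].
    - unfold D. rewrite Cmod_0. simpl. lra.
    - unfold D. rewrite Cmod_mult, Cmod_R, Rabs_pos_eq, Cmod_pow by apply pos_INR.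
      assert (Cmod z ^ m <= r ^ m) by (apply pow_incr; split; auto; apply Cmod_ge_0).
      replace (INR (S m) * r ^ S (S m)) with (r ^ 2 * (INR (S m) * r ^ m)) by (simpl; ring).
      apply Rmult_le_compat_l; [nra|]. apply Rmult_le_compat_l; [apply pos_INR|auto]. }
  induction n.
  - replace (v ^ 0 - z ^ 0 - D 0%nat * (v - z))%C with (RtoC 0) by (unfold D; simpl; ring).
    rewrite Cmod_0. simpl. lra.
  (* The remainders R n satisfy R (n+1) = v R n + D n (v - z)^2, because D (n+1) = z^n + z D n. The
     bound then propagates by n^2 + n <= (n+1)^2. *)
  - replace (v ^ S n - z ^ S n - D (S n) * (v - z))%C
      with (v * (v ^ n - z ^ n - D n * (v - z)) + D n * ((v - z) * (v - z)))%C.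
    2:{ assert (E : (D (S n) = z ^ n + D n * z)%C).
        { destruct n; unfold D; [simpl; ring|].
          rewrite (S_INR (S n)), RtoC_plus. simpl. ring. }
        rewrite E. simpl. ring. }
    apply Rle_trans with (r * (r ^ 2 * Cmod (v ^ n - z ^ n - D n * (v - z)))
      + r ^ 2 * Cmod (D n) * Cmod (v - z) ^ 2).
    { rewrite Rmult_assoc.
      replace (r * (r ^ 2 * Cmod (v ^ n - z ^ n - D n * (v - z))))
        with (r ^ 2 * (r * Cmod (v ^ n - z ^ n - D n * (v - z)))) by ring.
      rewrite <- Rmult_plus_distr_l. apply Rmult_le_compat_l; [nra|].
      eapply Rle_trans; [apply Cmod_triangle|]. rewrite !Cmod_mult.
      apply Rplus_le_compat; [|right; ring].
      apply Rmult_le_compat_r; [apply Cmod_ge_0|auto]. }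
    apply Rle_trans with (r * (INR n ^ 2 * r ^ n * Cmod (v - z) ^ 2)
      + INR n * r ^ S n * Cmod (v - z) ^ 2).
    { apply Rplus_le_compat.
      - apply Rmult_le_compat_l; lra.
      - apply Rmult_le_compat_r; auto. apply pow2_ge_0. }
    replace (r * (INR n ^ 2 * r ^ n * Cmod (v - z) ^ 2) + INR n * r ^ S n * Cmod (v - z) ^ 2)
      with ((INR n ^ 2 + INR n) * (r ^ S n * Cmod (v - z) ^ 2)) by (simpl; ring).
    rewrite (Rmult_assoc (INR (S n) ^ 2)). apply Rmult_le_compat_r.
    + apply Rmult_le_pos; [apply pow_le; lra|apply pow2_ge_0].
    + rewrite S_INR. generalize (pos_INR n). intros; nra.
Qed.

Lemma Rbar_lt_between (x : R) (l : Rbar) :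
  Rbar_lt x l -> exists r : R, x < r /\ Rbar_lt r l.
Proof.
  destruct l as [l| |]; simpl; intros H.
  - exists ((x + l) / 2). lra.
  - exists (x + 1). split; [lra|trivial].
  - easy.
Qed.

(** Termwise Taylor bounds sum up to a remainder of size K |v - z|^2 near [z], which is stronger
    than differentiability. *)
Lemma Cpseries_deriv (a : nat -> C) (z : C) :
  Rbar_lt (Cmod z) (Cradius a) ->
  complex_deriv (Cpseries a) z (Cpseries (Cderiv_coef a) z).
Proof.
  intros H. destruct (Rbar_lt_between _ _ H) as [r [Hr1 Hr2]].
  assert (Hr : 0 < r) by (generalize (Cmod_ge_0 z); lra).
  assert (Hd := H). rewrite <- Cradius_deriv in Hd.
  (* The factor 2 is that of [is_series_C_bound]; the division by r^2 undoes the scaling in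
     [Cpow_taylor_bound]. *)
  set (K := 2 * Series (fun n => Cmod (a n) * (INR n ^ 2 * r ^ n)) / r ^ 2).
  assert (HK : forall v, Cmod (v - z) < r - Cmod z ->
    Cmod (Cpseries a v - Cpseries a z - Cpseries (Cderiv_coef a) z * (v - z))
    <= K * Cmod (v - z) ^ 2).
  { intros v Hv.
    assert (Hvr : Cmod v <= r).
    { replace v with ((v - z) + z)%C by ring.
      eapply Rle_trans; [apply Cmod_triangle|lra]. }
    assert (Hva : Rbar_lt (Cmod v) (Cradius a)) by (eapply Rbar_le_lt_trans; [|apply Hr2]; auto).
    assert (S1 := Cpseries_is_series a v Hva).
    assert (S2 := Cpseries_is_series a z H).
    assert (S3 := is_series_scal_l (v - z)%C _ _ (Cpseries_is_series _ z Hd)).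
    set (D := fun n : nat => match n with O => 0 | S m => (INR (S m) * z ^ m)%C end : C).
    (* The differentiated series is reindexed to start at n = 1; [D 0] is 0, so the extra term of
       index 0 contributes nothing. *)
    assert (S4 : is_Cseries (fun n => (a n * (D n * (v - z)))%C)
                   (Cpseries (Cderiv_coef a) z * (v - z))%C).
    { apply is_series_decr_1.
      replace (plus _ _) with (scal (K := C_AbsRing) (V := C_NormedModule) (v - z)%C
        (Cpseries (Cderiv_coef a) z)).
      - eapply is_series_ext; [|apply S3]. intros n.
        change ((v - z) * (INR (S n) * a (S n) * z ^ n)
          = a (S n) * (INR (S n) * z ^ n * (v - z)))%C. ring.
      - change ((v - z) * Cpseries (Cderiv_coef a) z
          = Cpseries (Cderiv_coef a) z * (v - z) + - (a 0%nat * (0 * (v - z))))%C. ring. }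
    assert (S5 := is_series_minus _ _ _ _ (is_series_minus _ _ _ _ S1 S2) S4).
    assert (S6 : is_Cseries (fun n => (a n * (v ^ n - z ^ n - D n * (v - z)))%C)
      (Cpseries a v - Cpseries a z - Cpseries (Cderiv_coef a) z * (v - z))%C).
    { eapply is_series_ext; [|apply S5]. intros n.
      change ((a n * v ^ n + - (a n * z ^ n)) + - (a n * (D n * (v - z)))
        = a n * (v ^ n - z ^ n - D n * (v - z)))%C. ring. }
    assert (Hbd : forall n, Cmod (a n * (v ^ n - z ^ n - D n * (v - z))) <=
        (Cmod (v - z) ^ 2 / r ^ 2) * (Cmod (a n) * (INR n ^ 2 * r ^ n))).
    { intros n. rewrite Cmod_mult.
      generalize (Cpow_taylor_bound z v r n Hr (Rlt_le _ _ Hr1) Hvr). fold (D n). intros HT.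
      apply Rle_trans with (Cmod (a n) * ((INR n ^ 2 * r ^ n * Cmod (v - z) ^ 2) / r ^ 2)).
      - apply Rmult_le_compat_l; [apply Cmod_ge_0|].
        apply Rle_div_r; [nra|]. rewrite Rmult_comm. exact HT.
      - right. field. lra. }
    generalize (is_series_C_bound _ _ _ S6 Hbd
      (ex_series_scal_l _ _ (ex_series_Cmod_sqr a r (Rlt_le _ _ Hr) Hr2))).
    rewrite Series_scal_l. intros HH. eapply Rle_trans; [apply HH|].
    right. unfold K. field. lra. }
  apply complex_deriv_iff. intros eps.
  assert (Hm : 0 < Rmin (r - Cmod z) (eps / (Rabs K + 1))).
  { apply Rmin_glb_lt; [lra|]. apply Rdiv_lt_0_compat; [apply cond_pos|].
    generalize (Rabs_pos K); lra. }
  exists (mkposreal _ Hm). simpl. intros v Hv.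
  assert (H1 := Rlt_le_trans _ _ _ Hv (Rmin_l _ _)).
  assert (H2 := Rlt_le_trans _ _ _ Hv (Rmin_r _ _)).
  eapply Rle_trans; [apply HK; auto|].
  apply Rlt_div_r in H2; [|generalize (Rabs_pos K); lra].
  generalize (Cmod_ge_0 (v - z)) (Rle_abs K) (Rabs_pos K). intros.
  simpl. rewrite Rmult_1_r, <- Rmult_assoc. apply Rmult_le_compat_r; auto. nra.
Qed.

(** The derivative in direction h is the power series of [Cderiv_coef a] times h: a function of the
    same kind with the same radius. The induction on [k] therefore generalises [a]. *)
Lemma Cpseries_smooth (k : nat) (a : nat -> C) (w0 : C) (r : R) :
  Rbar_le r (Cradius a) ->
  let U := (fun w : C_R_NormedModule => Cmod (w - w0) < r) in
  Ck_on k U (fun w => Re (Cpseries a (w - w0)%C)) /\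
  Ck_on k U (fun w => Im (Cpseries a (w - w0)%C)).
Proof.
  intros Hr U. revert a Hr.
  assert (HU : open U) by apply open_disk.
  assert (Hlt : forall a w, Rbar_le r (Cradius a) -> U w -> Rbar_lt (Cmod (w - w0)) (Cradius a)).
  { intros a w Hr Hw. eapply Rbar_lt_le_trans; [|apply Hr]. exact Hw. }
  assert (Hd : forall a (w : C), Rbar_le r (Cradius a) -> U w ->
    complex_deriv (fun w => Cpseries a (w - w0)%C) w (Cpseries (Cderiv_coef a) (w - w0)%C)).
  { intros a w Hr Hw.
    assert (HD := Cpseries_deriv a _ (Hlt a w Hr Hw)). rewrite complex_deriv_iff in HD |- *.
    intros eps. destruct (HD eps) as [del Hdel]. exists del. intros v Hv.
    replace (v - w)%C with ((v - w0) - (w - w0))%C by ring. apply Hdel.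
    now replace ((v - w0) - (w - w0))%C with (v - w)%C by ring. }
  assert (Hc : forall a (w : C), Rbar_le r (Cradius a) -> U w ->
    continuous (T := C_UniformSpace) (U := C_UniformSpace) (fun w => Cpseries a (w - w0)%C) w).
  { intros a w Hr Hw. eapply complex_deriv_continuous. apply Hd; auto. }
  induction k; intros a Hr.
  - split; (split; [|trivial]); intros w Hw.
    + apply (continuous_Re (T := C_UniformSpace)). now apply Hc.
    + apply (continuous_Im (T := C_UniformSpace)). now apply Hc.
  - assert (Hr' := Hr). rewrite <- Cradius_deriv in Hr'.
    destruct (IHk _ Hr') as [IH1 IH2]. split.
    + apply (Ck_on_intro k U _ (fun w h => Re (Cpseries (Cderiv_coef a) (w - w0)%C * h)%C)); auto.
      * intros w Hw. apply (continuous_Re (T := C_UniformSpace) (fun w => Cpseries a (w - w0)%C)). now apply Hc.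
      * intros w h Hw. apply (complex_deriv_line (fun w => Cpseries a (w - w0)%C)). now apply Hd.
      * intros [h1 h2].
        apply (Ck_on_ext k U (fun w => Re (Cpseries (Cderiv_coef a) (w - w0)%C) * h1
           + Im (Cpseries (Cderiv_coef a) (w - w0)%C) * - h2)); auto.
        -- intros w _. simpl. ring.
        -- apply Ck_on_plus; auto; apply Ck_on_mult; auto; now apply Ck_on_const.
    + apply (Ck_on_intro k U _ (fun w h => Im (Cpseries (Cderiv_coef a) (w - w0)%C * h)%C)); auto.
      * intros w Hw. apply (continuous_Im (T := C_UniformSpace) (fun w => Cpseries a (w - w0)%C)). now apply Hc.
      * intros w h Hw. apply (complex_deriv_line (fun w => Cpseries a (w - w0)%C)). now apply Hd.
      * intros [h1 h2].
        apply (Ck_on_ext k U (fun w => Re (Cpseries (Cderiv_coef a) (w - w0)%C) * h2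
           + Im (Cpseries (Cderiv_coef a) (w - w0)%C) * h1)); auto.
        apply Ck_on_plus; auto; apply Ck_on_mult; auto; now apply Ck_on_const.
Qed.

(** * Analytic functions are smooth and holomorphic *)

Definition C1_holomorphic (D : C -> Prop) (f f' : C -> C) : Prop :=
  forall w, D w ->
    complex_deriv f w (f' w) /\
    continuous (T := C_UniformSpace) (U := C_UniformSpace) f' w.

(** The terms of a convergent series tend to 0, but beyond the radius of convergence they do not. *)
Lemma Cradius_ge (a : nat -> C) (r : R) (l : C) :
  0 <= r -> is_Cseries (fun n => (a n * RtoC r ^ n)%C) l ->
  Rbar_le r (Cradius a).
Proof.
  intros Hr H. apply Rbar_not_lt_le. intros Hlt.
  rewrite <- (Rabs_pos_eq r Hr) in Hlt. apply (CV_disk_outside _ _ Hlt).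
  apply is_series_C in H. destruct H as [H1 H2].
  assert (L1 := ex_series_lim_0 _ (ex_intro _ _ H1)).
  assert (L2 := ex_series_lim_0 _ (ex_intro _ _ H2)).
  apply is_lim_seq_abs in L1, L2. simpl in L1, L2. rewrite Rabs_R0 in L1, L2.
  assert (L := is_lim_seq_plus' _ _ _ _ L1 L2). rewrite Rplus_0_r in L.
  eapply is_lim_seq_le_le; [|apply is_lim_seq_const|apply L].
  intros n. split.
  - apply Rmult_le_pos; [apply Cmod_ge_0|now apply pow_le].
  - eapply Rle_trans; [|apply (Cmod_le_abs (a n * r ^ n))]. right.
    now rewrite Cmod_mult, Cmod_pow, Cmod_R, (Rabs_pos_eq r).
Qed.

Lemma analytic_local (W : C -> Prop) (f : C -> C) (w0 : C) :
  open (T := C_UniformSpace) W -> analytic_on W f -> W w0 ->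
  exists (a : nat -> C) (r : posreal), Rbar_le r (Cradius a) /\
    forall w, Cmod (w - w0) < r -> W w /\ f w = Cpseries a (w - w0)%C.
Proof.
  intros HW Hf Hw0. destruct (Hf w0 Hw0) as [a Ha]. exists a.
  apply locally_Cmod in Ha. destruct Ha as [d1 Ha].
  assert (HW0 := HW w0 Hw0). apply locally_Cmod in HW0. destruct HW0 as [d2 HW0].
  (* The expansion is known inside the open disk of radius [d1]. Evaluating it at the point w0 +
     d1/2 bounds the radius of convergence below by d1/2. *)
  assert (Hm : 0 < Rmin (d1 / 2) d2).
  { apply Rmin_glb_lt; [|apply cond_pos]. generalize (cond_pos d1); lra. }
  assert (Hrad : Rbar_le (d1 / 2) (Cradius a)).
  { assert (Hd : Cmod (w0 + RtoC (d1 / 2) - w0) < d1).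
    { replace (w0 + RtoC (d1 / 2) - w0)%C with (RtoC (d1 / 2)) by ring.
      rewrite Cmod_R, Rabs_pos_eq; generalize (cond_pos d1); lra. }
    specialize (Ha _ Hd). apply is_pseries_C in Ha.
    replace (w0 + RtoC (d1 / 2) - w0)%C with (RtoC (d1 / 2)) in Ha by ring.
    apply (Cradius_ge a (d1 / 2) _) in Ha; auto. generalize (cond_pos d1); lra. }
  assert (Hrad' : Rbar_le (Rmin (d1 / 2) d2) (Cradius a)).
  { eapply Rbar_le_trans; [|apply Hrad]. apply Rmin_l. }
  exists (mkposreal _ Hm). split; [exact Hrad'|]. simpl. intros w Hw. split.
  - apply HW0. eapply Rlt_le_trans; [apply Hw|apply Rmin_r].
  - assert (Hd1 : Cmod (w - w0) < d1).
    { eapply Rlt_le_trans; [apply Hw|]. eapply Rle_trans; [apply Rmin_l|].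
      generalize (cond_pos d1); lra. }
    specialize (Ha w Hd1). apply is_pseries_C in Ha.
    apply (is_series_C_unique _ _ _ Ha). apply Cpseries_is_series.
    eapply Rbar_lt_le_trans; [|apply Hrad']. exact Hw.
Qed.

Lemma analytic_smooth (W : C_R_NormedModule -> Prop) (f : C -> C) :
  open W -> analytic_on W f ->
  smooth_on W (fun w => Re (f w)) /\ smooth_on W (fun w => Im (f w)).
Proof.
  intros HW Hf. split; intros k; apply Ck_on_local; intros w0 Hw0;
  destruct (analytic_local W f w0 HW Hf Hw0) as [a [r [Hr Ha]]];
  exists (fun w : C_R_NormedModule => Cmod (w - w0) < r);
  (split; [replace (w0 - w0)%C with (RtoC 0) by ring; rewrite Cmod_0; apply cond_pos|]);
  [ apply (Ck_on_ext k _ (fun w => Re (Cpseries a (w - w0)%C)))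
  | apply (Ck_on_ext k _ (fun w => Im (Cpseries a (w - w0)%C))) ];
  try apply open_disk; try apply (Cpseries_smooth k a w0 r Hr);
  intros w Hw; symmetry; f_equal; now apply Ha.
Qed.

Lemma complex_deriv_ext_loc (f g : C -> C) (w d : C) :
  locally (T := C_UniformSpace) w (fun v => f v = g v) ->
  complex_deriv f w d -> complex_deriv g w d.
Proof.
  intros Hl. apply is_derive_ext_loc. now apply locally_C.
Qed.

Lemma complex_deriv_unique (f : C -> C) (w d d' : C) :
  complex_deriv f w d -> complex_deriv f w d' -> d = d'.
Proof.
  intros H H'. apply is_C_derive_unique in H, H'. congruence.
Qed.

Lemma complex_deriv_shift (f : C -> C) (w0 w d : C) :
  complex_deriv f (w - w0)%C d -> complex_deriv (fun v => f (v - w0)%C) w d.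
Proof.
  rewrite !complex_deriv_iff. intros H eps. destruct (H eps) as [del Hdel].
  exists del. intros v Hv.
  replace (v - w)%C with ((v - w0) - (w - w0))%C by ring. apply Hdel.
  now replace ((v - w0) - (w - w0))%C with (v - w)%C by ring.
Qed.

Lemma analytic_C1_holomorphic (W : C -> Prop) (f : C -> C) :
  open (T := C_UniformSpace) W -> analytic_on W f ->
  C1_holomorphic W f (C_derive f).
Proof.
  intros HW Hf w0 Hw0.
  destruct (analytic_local W f w0 HW Hf Hw0) as [a [r [Hr Ha]]].
  assert (Hd : forall w, Cmod (w - w0) < r ->
    complex_deriv f w (Cpseries (Cderiv_coef a) (w - w0)%C)).
  { intros w Hw.
    apply (complex_deriv_ext_loc (fun v => Cpseries a (v - w0)%C)).
    - apply (locally_mono (fun v => Cmod (v - w0) < r)).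
      + intros v Hv. symmetry. now apply Ha.
      + now apply (open_disk w0 r).
    - apply complex_deriv_shift, Cpseries_deriv.
      eapply Rbar_lt_le_trans; [|apply Hr]. exact Hw. }
  assert (H0 : Cmod (w0 - w0) < r).
  { replace (w0 - w0)%C with (RtoC 0) by ring. rewrite Cmod_0. apply cond_pos. }
  assert (Hc : forall w, Cmod (w - w0) < r -> C_derive f w = Cpseries (Cderiv_coef a) (w - w0)%C).
  { intros w Hw. apply is_C_derive_unique. now apply Hd. }
  split.
  - rewrite Hc; auto.
  - apply (continuous_ext_loc _ (fun w => Cpseries (Cderiv_coef a) (w - w0)%C)).
    + apply (locally_mono (fun v => Cmod (v - w0) < r)).
      * intros v Hv. symmetry. now apply Hc.
      * now apply (open_disk w0 r).
    + eapply complex_deriv_continuous. apply complex_deriv_shift, Cpseries_deriv.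
      rewrite Cradius_deriv. eapply Rbar_lt_le_trans; [|apply Hr]. exact H0.
Qed.

(** * Cauchy's integral formula *)

Lemma continuous_Cplus {T : UniformSpace} (f g : T -> C) (x : T) :
  Ccontinuous f x -> Ccontinuous g x -> Ccontinuous (fun y => (f y + g y)%C) x.
Proof.
  intros Hf Hg. apply (continuous_plus (V := C_R_NormedModule) f g x Hf Hg).
Qed.

Lemma continuous_Cmult {T : UniformSpace} (f g : T -> C) (x : T) :
  Ccontinuous f x -> Ccontinuous g x -> Ccontinuous (fun y => (f y * g y)%C) x.
Proof.
  intros Hf Hg. apply continuous_C_pair.
  - apply (continuous_minus (V := R_NormedModule) (fun y => Re (f y) * Re (g y)) (fun y => Im (f y) * Im (g y)));
    apply (continuous_mult (K := R_AbsRing)); auto using @continuous_Re, @continuous_Im.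
  - apply (continuous_plus (V := R_NormedModule) (fun y => Re (f y) * Im (g y)) (fun y => Im (f y) * Re (g y)));
    apply (continuous_mult (K := R_AbsRing)); auto using @continuous_Re, @continuous_Im.
Qed.

Lemma continuous_RtoC {T : UniformSpace} (f : T -> R) (x : T) :
  continuous f x -> Ccontinuous (fun y => RtoC (f y)) x.
Proof.
  intros H. apply continuous_C_pair; [exact H|apply continuous_const].
Qed.

Lemma continuous_Cinv {T : UniformSpace} (f : T -> C) (x : T) :
  Ccontinuous f x -> f x <> 0 -> Ccontinuous (fun y => (/ f y)%C) x.
Proof.
  intros H H0.
  assert (HN : Re (f x) ^ 2 + Im (f x) ^ 2 <> 0).
  { intros E. apply H0. apply injective_projections; simpl; unfold Re, Im in E; nra. }
  assert (Hi : continuous (fun y => / (Re (f y) ^ 2 + Im (f y) ^ 2)) x).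
  { apply (continuous_comp (fun y => Re (f y) ^ 2 + Im (f y) ^ 2) Rinv).
    - apply (continuous_ext (fun y => Re (f y) * Re (f y) + Im (f y) * Im (f y))).
      { intros y. simpl. now rewrite !Rmult_1_r. }
      apply (continuous_plus (V := R_NormedModule));
      apply (continuous_mult (K := R_AbsRing)); auto using @continuous_Re, @continuous_Im.
    - now apply continuous_Rinv. }
  apply continuous_C_pair.
  - apply (continuous_mult (K := R_AbsRing) (fun y => Re (f y))); auto using @continuous_Re.
  - apply (continuous_mult (K := R_AbsRing) (fun y => - Im (f y))); auto.
    apply (continuous_opp (V := R_NormedModule)). auto using @continuous_Im.
Qed.

(** * Complex integrals over the parameter interval of the circle *)

Definition is_CInt (g : R -> C) (l : C) : Prop :=
  is_RInt (fun t => Re (g t)) 0 (2 * PI) (Re l) /\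
  is_RInt (fun t => Im (g t)) 0 (2 * PI) (Im l).

Lemma is_CInt_ext (g h : R -> C) (l : C) :
  (forall t, g t = h t) -> is_CInt g l -> is_CInt h l.
Proof.
  intros E [H1 H2]. split; eapply is_RInt_ext; try eassumption;
  intros; cbv beta; now rewrite E.
Qed.

Lemma is_CInt_minus (g h : R -> C) (l m : C) :
  is_CInt g l -> is_CInt h m -> is_CInt (fun t => g t - h t)%C (l - m)%C.
Proof.
  intros [H1 H2] [H3 H4]. split.
  - apply (is_RInt_minus _ _ _ _ _ _ H1 H3).
  - apply (is_RInt_minus _ _ _ _ _ _ H2 H4).
Qed.

Lemma is_CInt_scal (c : C) (g : R -> C) (l : C) :
  is_CInt g l -> is_CInt (fun t => c * g t)%C (c * l)%C.
Proof.
  intros [H1 H2]. split.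
  - apply (is_RInt_minus _ _ _ _ _ _ (is_RInt_scal _ _ _ (Re c) _ H1) (is_RInt_scal _ _ _ (Im c) _ H2)).
  - apply (is_RInt_plus _ _ _ _ _ _ (is_RInt_scal _ _ _ (Re c) _ H2) (is_RInt_scal _ _ _ (Im c) _ H1)).
Qed.

Lemma is_CInt_continuous (g : R -> C) :
  (forall t, Ccontinuous g t) -> exists l, is_CInt g l.
Proof.
  intros H.
  assert (H1 : ex_RInt (fun t => Re (g t)) 0 (2 * PI)).
  { apply (ex_RInt_continuous (V := R_CompleteNormedModule)). intros t _. now apply continuous_Re. }
  assert (H2 : ex_RInt (fun t => Im (g t)) 0 (2 * PI)).
  { apply (ex_RInt_continuous (V := R_CompleteNormedModule)). intros t _. now apply continuous_Im. }
  destruct H1 as [l1 H1], H2 as [l2 H2]. now exists (l1, l2).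
Qed.

(** Each of the two components contributes 2 PI M; the sharp constant would be half as large. *)
Lemma is_CInt_bound (g : R -> C) (l : C) (M : R) :
  is_CInt g l -> (forall t, 0 <= t <= 2 * PI -> Cmod (g t) <= M) ->
  Cmod l <= 4 * PI * M.
Proof.
  intros [H1 H2] HM. assert (HPI := PI_RGT_0).
  eapply Rle_trans; [apply Cmod_le_abs|].
  rewrite <- (is_RInt_unique (V := R_CompleteNormedModule) _ _ _ _ H1).
  rewrite <- (is_RInt_unique (V := R_CompleteNormedModule) _ _ _ _ H2).
  replace (4 * PI * M) with ((2 * PI - 0) * M + (2 * PI - 0) * M) by ring.
  apply Rplus_le_compat; apply abs_RInt_le_const; try lra;
    try (eexists; eassumption); intros t Ht;
    apply Rle_trans with (Cmod (g t)); auto; [apply Re_le_Cmod|apply Im_le_Cmod].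
Qed.

Definition Cexp_neg (t : R) : C := (cos t, - sin t).
Definition Cexp_pos (t : R) : C := (cos t, sin t).

Lemma Cexp_pos_neg (t : R) : (Cexp_pos t * Cexp_neg t = 1)%C.
Proof.
  apply injective_projections; simpl; [|ring].
  generalize (sin2_cos2 t). unfold Rsqr. lra.
Qed.

Lemma Cmod_Cexp_pos (t : R) : Cmod (Cexp_pos t) = 1.
Proof.
  unfold Cmod, Cexp_pos. simpl. apply (fun H => eq_trans (f_equal sqrt H) sqrt_1).
  generalize (sin2_cos2 t). unfold Rsqr. lra.
Qed.

Lemma Cmod_Cexp_neg (t : R) : Cmod (Cexp_neg t) = 1.
Proof.
  unfold Cmod, Cexp_neg. simpl. apply (fun H => eq_trans (f_equal sqrt H) sqrt_1).
  generalize (sin2_cos2 t). unfold Rsqr. lra.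
Qed.

Lemma Cexp_neg_pow (t : R) (n : nat) : (Cexp_neg t ^ n)%C = Cexp_neg (INR n * t).
Proof.
  induction n.
  - unfold Cexp_neg. simpl. now rewrite Rmult_0_l, cos_0, sin_0, Ropp_0.
  - rewrite Cpow_S, IHn, S_INR. unfold Cexp_neg.
    replace ((INR n + 1) * t) with (t + INR n * t) by ring.
    rewrite cos_plus, sin_plus.
    apply injective_projections; simpl; ring.
Qed.

Lemma continuous_of_ex_derive (f : R -> R) (t : R) : ex_derive f t -> continuous f t.
Proof. apply (ex_derive_continuous (V := R_NormedModule)). Qed.

Lemma continuous_Cexp_pos (t : R) : Ccontinuous Cexp_pos t.
Proof.
  apply continuous_C_pair; simpl; apply continuous_of_ex_derive; auto_derive; trivial.
Qed.

Lemma continuous_Cexp_neg (t : R) : Ccontinuous Cexp_neg t.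
Proof.
  apply continuous_C_pair; simpl; apply continuous_of_ex_derive; auto_derive; trivial.
Qed.

(** For n > 0 the components of e^(-int) have primitives of period 2 PI. This evaluates the integral
    of the Cauchy kernel below. *)
Lemma is_CInt_Cexp_neg_pow (n : nat) :
  is_CInt (fun t => Cexp_neg t ^ n)%C (match n with O => RtoC (2 * PI) | S _ => 0 end).
Proof.
  destruct n as [|n].
  - split; simpl.
    + replace (2 * PI) with (scal (2 * PI - 0) 1) at 2.
      * apply (is_RInt_const 0 (2 * PI) (1 : R_NormedModule)).
      * unfold scal; simpl; unfold mult; simpl; ring.
    + replace 0 with (scal (2 * PI - 0) 0) at 2.
      * apply (is_RInt_const 0 (2 * PI) (0 : R_NormedModule)).
      * unfold scal; simpl; unfold mult; simpl; ring.
  - assert (Hn : INR (S n) <> 0) by (apply not_0_INR; discriminate).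
    assert (Hs : sin (INR (S n) * (2 * PI)) = 0).
    { replace (INR (S n) * (2 * PI)) with (0 + 2 * INR (S n) * PI) by ring.
      now rewrite sin_period, sin_0. }
    assert (Hc : cos (INR (S n) * (2 * PI)) = 1).
    { replace (INR (S n) * (2 * PI)) with (0 + 2 * INR (S n) * PI) by ring.
      now rewrite cos_period, cos_0. }
    apply is_CInt_ext with (fun t => Cexp_neg (INR (S n) * t)).
    { intros t. now rewrite Cexp_neg_pow. }
    set (m := INR (S n)) in *. split; cbn [Re Im fst snd Cexp_neg].
    + replace (Re 0) with (minus (sin (m * (2 * PI)) / m) (sin (m * 0) / m)).
      * apply (is_RInt_derive (fun t => sin (m * t) / m)).
        -- intros t _. auto_derive; trivial. now field.
        -- intros t _. apply continuous_of_ex_derive; auto_derive; trivial.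
      * rewrite Hs, Rmult_0_r, sin_0. unfold minus, plus, opp; simpl. field; auto.
    + replace (Im 0) with (minus (cos (m * (2 * PI)) / m) (cos (m * 0) / m)).
      * apply (is_RInt_derive (fun t => cos (m * t) / m)).
        -- intros t _. auto_derive; trivial. now field.
        -- intros t _. apply continuous_of_ex_derive; auto_derive; trivial.
      * rewrite Hc, Rmult_0_r, cos_0. unfold minus, plus, opp; simpl. field; auto.
Qed.

(** * Power series expansion of Cauchy integrals *)

Lemma is_series_C_intro (u : nat -> C) (l : C) :
  (forall eps : posreal, exists N, forall n, (N <= n)%nat ->
     Cmod (sum_n (G := C_NormedModule) u n - l) < eps) -> is_Cseries u l.
Proof.
  intros H. apply (filterlim_locally (U := C_UniformSpace)). intros eps.
  destruct (H eps) as [N HN]. exists N. intros n Hn. specialize (HN n Hn).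
  split.
  - eapply Rle_lt_trans; [apply (Re_le_Cmod (sum_n (G := C_NormedModule) u n - l))|exact HN].
  - eapply Rle_lt_trans; [apply (Im_le_Cmod (sum_n (G := C_NormedModule) u n - l))|exact HN].
Qed.

Lemma one_minus_neq_0 (q : C) : Cmod q < 1 -> (1 - q)%C <> 0.
Proof.
  intros Hq E. assert (q = 1).
  { replace q with (1 - (1 - q))%C by ring. rewrite E. ring. }
  subst q. rewrite Cmod_1 in Hq. lra.
Qed.

(* [1 / (1 - s e^(-it))] is the Cauchy kernel [zeta / (zeta - s)] on the unit
   circle [zeta = e^(it)]. *)
Lemma Cauchy_kernel_series (g : R -> C) (s L : C) (b : nat -> C) :
  (forall t, Ccontinuous g t) -> Cmod s < 1 ->
  (forall n, is_CInt (fun t => g t * Cexp_neg t ^ n)%C (b n)) ->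
  is_CInt (fun t => g t * / (1 - s * Cexp_neg t))%C L ->
  is_Cseries (fun n => b n * s ^ n)%C L.
Proof.
  intros Hg Hs Hb HL.
  assert (Hq : forall t, Cmod (s * Cexp_neg t) = Cmod s).
  { intros t. now rewrite Cmod_mult, Cmod_Cexp_neg, Rmult_1_r. }
  assert (Hq1 : forall t, (1 - s * Cexp_neg t)%C <> 0).
  { intros t. apply one_minus_neq_0. now rewrite Hq. }
  (* The finite geometric sum has an exact remainder, so no exchange of an infinite sum with the
     integral is needed: the integral of the remainder is estimated directly. *)
  assert (Hrem : forall n, is_CInt
    (fun t => g t * (s * Cexp_neg t) ^ S n * / (1 - s * Cexp_neg t))%C
    (L - sum_n (G := C_NormedModule) (fun n => b n * s ^ n)%C n)%C).
  { induction n.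
    - rewrite sum_O, (Cmult_comm (b 0%nat)).
      eapply is_CInt_ext; [|apply (is_CInt_minus _ _ _ _ HL (is_CInt_scal (s ^ 0) _ _ (Hb 0%nat)))].
      intros t. simpl. field. apply Hq1.
    - rewrite sum_Sn.
      replace (L - _)%C with (L - sum_n (G := C_NormedModule) (fun n => b n * s ^ n)%C n
        - s ^ S n * b (S n))%C.
      2:{ change (L - sum_n (G := C_NormedModule) (fun n => b n * s ^ n)%C n - s ^ S n * b (S n)
            = L - (sum_n (G := C_NormedModule) (fun n => b n * s ^ n)%C n
                   + b (S n) * s ^ S n))%C. ring. }
      eapply is_CInt_ext; [|apply (is_CInt_minus _ _ _ _ IHn (is_CInt_scal (s ^ S n) _ _ (Hb (S n))))].
      intros t. rewrite !Cpow_mult_l, !Cpow_S. field. apply Hq1. }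
  destruct (bounded_continuity (K := C_AbsRing) (V := C_NormedModule) g 0 (2 * PI)
    (fun t _ => Hg t)) as [M HM].
  change (forall t, 0 <= t <= 2 * PI -> Cmod (g t) < M) in HM.
  assert (HM0 : 0 <= M).
  { assert (H0 : 0 <= 0 <= 2 * PI) by (generalize PI_RGT_0; lra).
    generalize (HM 0 H0) (Cmod_ge_0 (g 0)). lra. }
  assert (HPI := PI_RGT_0).
  assert (Hbound : forall n, Cmod (L - sum_n (G := C_NormedModule) (fun n => b n * s ^ n)%C n)
    <= 4 * PI * (M / (1 - Cmod s)) * Cmod s ^ S n).
  { intros n. rewrite Rmult_assoc. apply (is_CInt_bound _ _ _ (Hrem n)).
    intros t Ht. rewrite !Cmod_mult, Cmod_inv, Cmod_pow, Hq by apply Hq1.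
    assert (Hk : / Cmod (1 - s * Cexp_neg t) <= / (1 - Cmod s)).
    { apply Rinv_le_contravar; [lra|].
      assert (HT := Cmod_triangle (1 - s * Cexp_neg t) (s * Cexp_neg t)).
      replace (1 - s * Cexp_neg t + s * Cexp_neg t)%C with (RtoC 1) in HT by ring.
      rewrite Hq, Cmod_1 in HT. lra. }
    assert (Hgt : Cmod (g t) <= M) by (left; now apply HM).
    assert (Hp : 0 <= Cmod s ^ S n) by (apply pow_le, Cmod_ge_0).
    replace (M / (1 - Cmod s) * Cmod s ^ S n) with (M * Cmod s ^ S n * / (1 - Cmod s))
      by (field; lra).
    apply Rmult_le_compat; auto.
    - apply Rmult_le_pos; auto. apply Cmod_ge_0.
    - left. apply Rinv_0_lt_compat. apply Cmod_gt_0, Hq1.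
    - now apply Rmult_le_compat_r. }
  apply is_series_C_intro. intros eps.
  assert (Hgeom : is_lim_seq (fun n => 4 * PI * (M / (1 - Cmod s)) * Cmod s ^ S n) 0).
  { replace (Finite 0) with (Rbar_mult (4 * PI * (M / (1 - Cmod s))) 0)
      by (simpl; now rewrite Rmult_0_r).
    apply is_lim_seq_scal_l. apply (is_lim_seq_incr_1 (fun n => Cmod s ^ n)).
    apply is_lim_seq_geom. rewrite Rabs_pos_eq; auto. apply Cmod_ge_0. }
  apply is_lim_seq_spec in Hgeom. destruct (Hgeom eps) as [N HN].
  exists N. intros n Hn. specialize (HN n Hn). rewrite Rminus_0_r in HN.
  eapply Rle_lt_trans; [|apply HN]. eapply Rle_trans; [|apply Rle_abs].
  eapply Rle_trans; [|apply Hbound]. right. rewrite <- Cmod_opp. f_equal. ring.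
Qed.

(** The expansion is applied to the constant function 1, all of whose coefficients except the one of
    index 0 vanish. *)
Lemma is_CInt_Cauchy_kernel (s : C) :
  Cmod s < 1 -> is_CInt (fun t => / (1 - s * Cexp_neg t))%C (RtoC (2 * PI)).
Proof.
  intros Hs.
  destruct (is_CInt_continuous (fun t => 1 * / (1 - s * Cexp_neg t))%C) as [L HL].
  { intros t. apply continuous_Cmult; [apply continuous_const|].
    apply continuous_Cinv.
    - apply (continuous_minus (V := C_R_NormedModule)); [apply continuous_const|].
      apply continuous_Cmult; [apply continuous_const|apply continuous_Cexp_neg].
    - apply one_minus_neq_0. now rewrite Cmod_mult, Cmod_Cexp_neg, Rmult_1_r. }
  assert (HS := Cauchy_kernel_series (fun _ => 1) s L
    (fun n => match n with O => RtoC (2 * PI) | S _ => 0 end)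
    (fun t => continuous_const _ _) Hs
    (fun n => is_CInt_ext _ _ _ (fun t => eq_sym (Cmult_1_l _)) (is_CInt_Cexp_neg_pow n)) HL).
  replace (RtoC (2 * PI)) with L.
  - eapply is_CInt_ext; [|apply HL]. intros t. apply Cmult_1_l.
  - apply (is_series_C_unique _ _ _ HS).
    apply is_series_C_intro. intros eps. exists 0%nat. intros n _.
    replace (sum_n _ n) with (RtoC (2 * PI)).
    + replace (RtoC (2 * PI) - RtoC (2 * PI))%C with (RtoC 0) by ring.
      rewrite Cmod_0. apply cond_pos.
    + symmetry. induction n.
      * rewrite sum_O. simpl. apply Cmult_1_r.
      * rewrite sum_Sn, IHn.
        change (RtoC (2 * PI) + 0 * s ^ S n = RtoC (2 * PI))%C. ring.
Qed.

Lemma is_derive_scal_comp_complex (k : C) (f : C -> C) (x y : R -> R) (t dx dy : R) (d : C) :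
  complex_deriv f (x t, y t) d -> is_derive x t dx -> is_derive y t dy ->
  is_derive (fun s => Re (k * f (x s, y s))%C) t (Re (k * (d * (dx, dy)))%C).
Proof.
  intros Hf Hx Hy. destruct (is_derive_comp_complex _ _ _ _ _ _ _ Hf Hx Hy) as [H1 H2].
  exact (is_derive_minus _ _ _ _ _ (is_derive_scal _ _ (Re k) _ H1) (is_derive_scal _ _ (Im k) _ H2)).
Qed.

(* The integral of [f (w + s (zeta - w)) / (zeta - w)] over the circle does not
   depend on [s]: its [s]-derivative integrates an exact differential. The value
   at [s = 0] involves only the kernel. Since [s] ranges over an open interval
   around [[0, 1]], the point [w + s (zeta - w)] stays within [3 r] of [w0]. *)
Section CauchyFormula.

Variables (f f' : C -> C) (w0 w : C) (r : R).
Hypothesis r_pos : 0 < r.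
Hypothesis f_holo : C1_holomorphic (fun v => Cmod (v - w0) < 4 * r) f f'.
Hypothesis w_in : Cmod (w - w0) < r.

Let circle (t : R) : C := (w0 + r * Cexp_pos t)%C.
Let path (s t : R) : C := (w + s * (circle t - w))%C.
Let path_re (s t : R) : R := Re w + s * (Re w0 + r * cos t - Re w).
Let path_im (s t : R) : R := Im w + s * (Im w0 + r * sin t - Im w).
(** With zeta = [circle t] this is (zeta - w0) / (zeta - w). As d(zeta) = i (zeta - w0) dt,
    integrating against [kernel t] dt is integrating against d(zeta) / (i (zeta - w)). *)
Let kernel (t : R) : C := (/ (1 - (w - w0) / r * Cexp_neg t))%C.

Let r_neq_0 : RtoC r <> 0.
Proof. intros E. apply RtoC_inj in E. lra. Qed.

Let s_lt : Cmod ((w - w0) / r) < 1.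
Proof.
  rewrite Cmod_div, Cmod_R, Rabs_pos_eq by (auto; lra).
  apply Rlt_div_l; lra.
Qed.

Let denominator_neq_0 (t : R) : (1 - (w - w0) / r * Cexp_neg t)%C <> 0.
Proof. apply one_minus_neq_0. now rewrite Cmod_mult, Cmod_Cexp_neg, Rmult_1_r. Qed.

Let circle_kernel (t : R) : ((circle t - w) * kernel t = r * Cexp_pos t)%C.
Proof.
  unfold kernel, circle.
  replace (w0 + r * Cexp_pos t - w)%C
    with (r * Cexp_pos t * (1 - (w - w0) / r * Cexp_neg t))%C.
  - rewrite <- Cmult_assoc, Cinv_r by apply denominator_neq_0. ring.
  - transitivity (r * Cexp_pos t - (w - w0) * (Cexp_pos t * Cexp_neg t))%C; [now field|].
    rewrite Cexp_pos_neg. ring.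
Qed.

Let path_in (s t : R) : -1 < s < 2 -> Cmod (path s t - w0) < 4 * r.
Proof.
  intros Hs. unfold path, circle.
  replace (w + s * (w0 + r * Cexp_pos t - w) - w0)%C
    with (RtoC (1 - s) * (w - w0) + RtoC s * (r * Cexp_pos t))%C
    by (rewrite RtoC_minus; ring).
  eapply Rle_lt_trans; [apply Cmod_triangle|].
  rewrite !Cmod_mult, !Cmod_R, Cmod_Cexp_pos, (Rabs_pos_eq r) by lra.
  assert (H1 : Rabs (1 - s) * Cmod (w - w0) <= Rabs (1 - s) * r).
  { apply Rmult_le_compat_l; [apply Rabs_pos|lra]. }
  assert (H2 : Rabs (1 - s) + Rabs s < 4).
  { unfold Rabs. destruct (Rcase_abs _), (Rcase_abs _); lra. }
  nra.
Qed.

Let path_pair (s t : R) : path s t = (path_re s t, path_im s t).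
Proof. apply injective_projections; unfold path, path_re, path_im, circle, Re, Im; simpl; ring. Qed.

Let kernel_continuous (t : R) : Ccontinuous kernel t.
Proof.
  apply continuous_Cinv; [|apply denominator_neq_0].
  apply (continuous_minus (V := C_R_NormedModule)); [apply continuous_const|].
  apply continuous_Cmult; [apply continuous_const|apply continuous_Cexp_neg].
Qed.

Let path_continuous (p : R * R) :
  continuous (T := prod_UniformSpace R_UniformSpace R_UniformSpace) (U := C_UniformSpace)
    (fun q => path (fst q) (snd q)) p.
Proof.
  unfold path, circle.
  apply continuous_Cplus; [apply continuous_const|]. apply continuous_Cmult.
  - apply continuous_RtoC, continuous_fst.
  - apply continuous_Cplus; [|apply continuous_const].
    apply continuous_Cplus; [apply continuous_const|].
    apply continuous_Cmult; [apply continuous_const|].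
    apply (continuous_comp snd Cexp_pos); [apply continuous_snd|apply continuous_Cexp_pos].
Qed.

Let path_continuous_r (s t : R) : Ccontinuous (path s) t.
Proof.
  apply (continuous_comp_2 (fun _ => s) (fun t => t) path);
    [apply continuous_const|apply continuous_id|apply path_continuous].
Qed.

(** The inner derivative [circle t - w] cancels the denominator of the kernel. The constant [c] lets
    one real statement serve for both components of a complex value: c = 1 gives the real part, c =
    -i the imaginary part. *)
Let path_deriv_l (c : C) (s t : R) : -1 < s < 2 ->
  is_derive (fun u => Re (c * kernel t * f (path u t))%C) s
    (Re (c * (f' (path s t) * (r * Cexp_pos t)))%C).
Proof.
  intros Hs.
  apply (is_derive_ext (fun u : R => Re (c * kernel t * f (path_re u t, path_im u t))%C)).
  { intros u. now rewrite path_pair. }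
  replace (c * (f' (path s t) * (r * Cexp_pos t)))%C
    with (c * kernel t * (f' (path s t) *
      (Re w0 + r * cos t - Re w, Im w0 + r * sin t - Im w)%R))%C.
  - apply (is_derive_scal_comp_complex (c * kernel t) f).
    + rewrite <- path_pair. apply f_holo. now apply path_in.
    + unfold path_re, path_im. auto_derive; trivial. ring.
    + unfold path_re, path_im. auto_derive; trivial. ring.
  - rewrite <- circle_kernel.
    replace (circle t - w)%C with (Re w0 + r * cos t - Re w, Im w0 + r * sin t - Im w).
    + ring.
    + apply injective_projections; unfold circle, Re, Im; simpl; ring.
Qed.

(** The right-hand side is that of [path_deriv_l], now exhibited as a derivative in t. The velocity
    of [path s] is i s r e^(it), whence the division by i s and the restriction to s > 0. *)
Let path_deriv_r (c : C) (s t : R) : 0 < s < 1 ->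
  is_derive (fun u => Re (c / (Ci * s) * f (path s u))%C) t
    (Re (c * (f' (path s t) * (r * Cexp_pos t)))%C).
Proof.
  intros Hs.
  assert (Hs0 : RtoC s <> 0) by (intros E; apply RtoC_inj in E; lra).
  apply (is_derive_ext (fun u : R => Re (c / (Ci * s) * f (path_re s u, path_im s u))%C)).
  { intros u. now rewrite path_pair. }
  replace (c * (f' (path s t) * (r * Cexp_pos t)))%C
    with (c / (Ci * s) * (f' (path s t) * (- s * r * sin t, s * r * cos t)%R))%C.
  - apply (is_derive_scal_comp_complex (c / (Ci * s)) f).
    + rewrite <- path_pair. apply f_holo. apply path_in. lra.
    + unfold path_re, path_im. auto_derive; trivial. ring.
    + unfold path_re, path_im. auto_derive; trivial. ring.
  - replace ((- s * r * sin t, s * r * cos t) : C) with (Ci * s * (r * Cexp_pos t))%C.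
    + field. split; auto. apply Ci_nz.
    + apply injective_projections; simpl; ring.
Qed.

Let deriv_continuous (c : C) (s t : R) : -1 < s < 2 ->
  continuous (T := prod_UniformSpace R_UniformSpace R_UniformSpace)
    (fun q => Re (c * (f' (path (fst q) (snd q)) * (r * Cexp_pos (snd q))))%C) (s, t).
Proof.
  intros Hs. apply continuous_Re.
  apply continuous_Cmult; [apply continuous_const|]. apply continuous_Cmult.
  - apply (continuous_comp (fun q : R * R => path (fst q) (snd q)) f').
    + apply path_continuous.
    + apply f_holo. now apply path_in.
  - apply continuous_Cmult; [apply continuous_const|].
    apply (continuous_comp snd Cexp_pos); [apply continuous_snd|apply continuous_Cexp_pos].
Qed.

Let integral_deriv_0 (c : C) (s : R) : 0 < s < 1 ->
  RInt (fun t => Re (c * (f' (path s t) * (r * Cexp_pos t)))%C) 0 (2 * PI) = 0.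
Proof.
  intros Hs.
  assert (H := is_RInt_derive (V := R_CompleteNormedModule)
    (fun u => Re (c / (Ci * s) * f (path s u))%C)
    (fun t => Re (c * (f' (path s t) * (r * Cexp_pos t)))%C) 0 (2 * PI)
    (fun t _ => path_deriv_r c s t Hs)).
  apply (is_RInt_unique (V := R_CompleteNormedModule)) in H.
  - rewrite H. unfold path, circle, Cexp_pos.
    rewrite cos_2PI, sin_2PI, cos_0, sin_0. apply (minus_eq_zero (G := R_AbelianGroup)).
  - intros t _.
    apply (continuous_comp_2 (fun _ => s) (fun t => t)
      (fun s t => Re (c * (f' (path s t) * (r * Cexp_pos t)))%C));
      [apply continuous_const|apply continuous_id|].
    apply deriv_continuous. lra.
Qed.

Let integrand_continuous (c : C) (s t : R) : -1 < s < 2 ->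
  Ccontinuous (fun t => c * kernel t * f (path s t))%C t.
Proof.
  intros Hs. apply continuous_Cmult.
  - apply continuous_Cmult; [apply continuous_const|apply kernel_continuous].
  - apply (continuous_comp (path s) f); [apply path_continuous_r|].
    eapply complex_deriv_continuous. apply f_holo. now apply path_in.
Qed.

Let integral_deriv (c : C) (s : R) : -1 < s < 2 ->
  is_derive (fun u => RInt (fun t => Re (c * kernel t * f (path u t))%C) 0 (2 * PI)) s
    (RInt (fun t => Re (c * (f' (path s t) * (r * Cexp_pos t)))%C) 0 (2 * PI)).
Proof.
  intros Hs.
  assert (Hloc : locally s (fun u => -1 < u < 2)).
  { apply (open_and _ _ (open_gt (-1)) (open_lt 2)). exact Hs. }
  replace (RInt (fun t => Re (c * (f' (path s t) * (r * Cexp_pos t)))%C) 0 (2 * PI))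
    with (RInt (fun t => Derive (fun u => Re (c * kernel t * f (path u t))%C) s) 0 (2 * PI)).
  2:{ apply RInt_ext. intros t _. apply is_derive_unique. now apply path_deriv_l. }
  apply (is_derive_RInt_param (fun u t => Re (c * kernel t * f (path u t))%C)).
  - apply (filter_imp (fun u => -1 < u < 2)); auto.
    intros u Hu t _. eexists. now apply path_deriv_l.
  - intros t _.
    apply continuity_2d_pt_ext_loc with
      (fun s t => Re (c * (f' (path s t) * (r * Cexp_pos t)))%C).
    + destruct Hloc as [eps Heps]. exists eps. intros u v Hu Hv.
      symmetry. apply is_derive_unique. apply path_deriv_l. apply Heps. exact Hu.
    + apply continuity_2d_pt_filterlim. now apply deriv_continuous.
  - apply (filter_imp (fun u => -1 < u < 2)); auto.
    intros u Hu. apply (ex_RInt_continuous (V := R_CompleteNormedModule)).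
    intros t _. apply continuous_Re. now apply integrand_continuous.
Qed.

(** The mean value theorem wants a derivative on all of [0, 1] but evaluates it at an interior
    point, where division by s is allowed and the derivative is 0. *)
Let integral_const (c : C) :
  RInt (fun t => Re (c * kernel t * f (path 1 t))%C) 0 (2 * PI)
  = RInt (fun t => Re (c * kernel t * f (path 0 t))%C) 0 (2 * PI).
Proof.
  destruct (MVT_cor2 (fun u => RInt (fun t => Re (c * kernel t * f (path u t))%C) 0 (2 * PI))
    (fun s => RInt (fun t => Re (c * (f' (path s t) * (r * Cexp_pos t)))%C) 0 (2 * PI)) 0 1)
    as [s [Hs1 Hs2]].
  - lra.
  - intros s Hs. apply is_derive_Reals. apply integral_deriv. lra.
  - rewrite integral_deriv_0 in Hs1 by auto. lra.
Qed.

Lemma Cauchy_formula :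
  is_CInt (fun t => f (circle t) * kernel t)%C (f w * RtoC (2 * PI))%C.
Proof.
  destruct (is_CInt_continuous (fun t => 1 * kernel t * f (path 1 t))%C) as [L HL].
  { intros t. apply integrand_continuous. lra. }
  assert (H0 : is_CInt (fun t => 1 * kernel t * f (path 0 t))%C (f w * RtoC (2 * PI))%C).
  { eapply is_CInt_ext; [|apply is_CInt_scal, (is_CInt_Cauchy_kernel _ s_lt)].
    intros t. cbv beta. replace (path 0 t) with w by (unfold path; ring).
    unfold kernel. ring. }
  replace (f w * RtoC (2 * PI))%C with L.
  - eapply is_CInt_ext; [|apply HL]. intros t. cbv beta.
    replace (path 1 t) with (circle t) by (unfold path; ring). ring.
  - destruct HL as [L1 L2], H0 as [M1 M2].
    apply (is_RInt_unique (V := R_CompleteNormedModule)) in L1, L2, M1, M2.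
    assert (E1 := integral_const 1). assert (E2 := integral_const (- Ci)).
    assert (HIm : forall z, Im (1 * z)%C = Re (- Ci * z)%C) by (intros z; simpl; ring).
    apply injective_projections.
    + change (Re L = Re (f w * RtoC (2 * PI))%C). congruence.
    + change (Im L = Im (f w * RtoC (2 * PI))%C). rewrite <- L2, <- M2.
      etransitivity; [|etransitivity; [exact E2|]]; apply RInt_ext; intros t _;
      rewrite <- !Cmult_assoc, HIm; reflexivity.
Qed.

End CauchyFormula.

Lemma C1_holomorphic_analytic (D : C -> Prop) (f f' : C -> C) :
  open (T := C_UniformSpace) D -> C1_holomorphic D f f' -> analytic_on D f.
Proof.
  intros HD Hf w0 Hw0.
  assert (Hl := HD w0 Hw0). apply locally_Cmod in Hl. destruct Hl as [d Hd].
  (* [Cauchy_formula] on the circle of radius [r] asks for holomorphy within 4 r. *)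
  set (r := d / 4).
  assert (Hr : 0 < r) by (generalize (cond_pos d); unfold r; lra).
  assert (Hr0 : RtoC r <> 0) by (intros E; apply RtoC_inj in E; lra).
  assert (Hf' : C1_holomorphic (fun v => Cmod (v - w0) < 4 * r) f f').
  { intros v Hv. apply Hf, Hd. unfold r in Hv. lra. }
  assert (Hg : forall t, Ccontinuous (fun t => f (w0 + r * Cexp_pos t)%C) t).
  { intros t. apply (continuous_comp (fun t => (w0 + r * Cexp_pos t)%C : C_UniformSpace) f).
    - apply continuous_Cplus; [apply continuous_const|].
      apply continuous_Cmult; [apply continuous_const|apply continuous_Cexp_pos].
    - eapply complex_deriv_continuous. apply Hf'.
      replace (w0 + r * Cexp_pos t - w0)%C with (r * Cexp_pos t)%C by ring.
      rewrite Cmod_mult, Cmod_R, Cmod_Cexp_pos, Rabs_pos_eq; lra. }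
  assert (Hb : forall n, exists b, is_CInt (fun t => f (w0 + r * Cexp_pos t) * Cexp_neg t ^ n)%C b).
  { intros n. apply is_CInt_continuous. intros t. apply continuous_Cmult; auto.
    induction n; [apply continuous_const|].
    apply (continuous_Cmult Cexp_neg); [apply continuous_Cexp_neg|exact IHn]. }
  set (b := fun n => (RInt (fun t => Re (f (w0 + r * Cexp_pos t) * Cexp_neg t ^ n)%C) 0 (2 * PI),
     RInt (fun t => Im (f (w0 + r * Cexp_pos t) * Cexp_neg t ^ n)%C) 0 (2 * PI)) : C).
  assert (Hb' : forall n, is_CInt (fun t => f (w0 + r * Cexp_pos t) * Cexp_neg t ^ n)%C (b n)).
  { intros n. destruct (Hb n) as [l [H1 H2]]. unfold b. split; simpl.
    - erewrite (is_RInt_unique (V := R_CompleteNormedModule)) by exact H1. exact H1.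
    - erewrite (is_RInt_unique (V := R_CompleteNormedModule)) by exact H2. exact H2. }
  assert (HPI : RtoC (2 * PI) <> 0).
  { intros E. apply RtoC_inj in E. generalize PI_RGT_0; lra. }
  (* The Cauchy coefficients: the kernel is expanded in powers of (w - w0) / r, which accounts for
     r^n, and the formula yields 2 PI times f w. *)
  exists (fun n => b n / (RtoC (2 * PI) * r ^ n))%C.
  apply locally_Cmod. exists (mkposreal r Hr). simpl. intros w Hw.
  apply is_pseries_C.
  assert (Hs : Cmod ((w - w0) / r) < 1).
  { rewrite Cmod_div, Cmod_R, Rabs_pos_eq by (auto; lra). apply Rlt_div_l; lra. }
  assert (HC := Cauchy_formula f f' w0 w r Hr Hf' Hw).
  assert (HS := Cauchy_kernel_series _ _ _ b Hg Hs Hb' HC).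
  apply (is_series_scal_l (/ RtoC (2 * PI))%C) in HS.
  replace (f w) with (scal (K := C_AbsRing) (V := C_NormedModule) (/ RtoC (2 * PI))%C (f w * RtoC (2 * PI))%C).
  - eapply is_series_ext; [|apply HS]. intros n.
    change (/ RtoC (2 * PI) * (b n * ((w - w0) / r) ^ n)
      = b n / (RtoC (2 * PI) * r ^ n) * (w - w0) ^ n)%C.
    unfold Cdiv. rewrite Cpow_mult_l, Cpow_inv by auto. field. split; auto.
    now apply Cpow_nz.
  - change (/ RtoC (2 * PI) * (f w * RtoC (2 * PI)) = f w)%C. now field.
Qed.

(** * Inverse functions *)

(** The mean value theorem holds for real-valued functions only. It is applied to the real part of k
    times f along the segment, for k = 1 and k = -i, and adding the two components gives the factor
    2. *)
Lemma Cmean_value (f f' : C -> C) (a b c : C) (M : R) :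
  (forall t : R, 0 <= t <= 1 ->
     complex_deriv f (a + t * (b - a))%C (f' (a + t * (b - a))%C) /\
     Cmod (f' (a + t * (b - a)) - c)%C <= M) ->
  Cmod (f b - f a - c * (b - a)) <= 2 * M * Cmod (b - a).
Proof.
  intros H.
  assert (HK : forall k : C, Cmod k = 1 ->
    Rabs (Re (k * (f b - f a - c * (b - a)))%C) <= M * Cmod (b - a)).
  { intros k Hk.
    set (p := fun t : R => (a + t * (b - a))%C).
    assert (Hp : forall t, p t = (Re a + t * (Re b - Re a), Im a + t * (Im b - Im a))).
    { intros t. unfold p. apply injective_projections; unfold Re, Im; simpl; ring. }
    destruct (MVT_cor2 (fun t => Re (k * f (p t))%C - t * Re (k * (c * (b - a)))%C)
      (fun t => Re (k * ((f' (p t) - c) * (b - a)))%C) 0 1) as [t [Ht1 Ht2]].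
    - lra.
    - intros t Ht. apply is_derive_Reals.
      replace (Re (k * ((f' (p t) - c) * (b - a))))%C
        with (Re (k * (f' (p t) * (b - a)))%C - Re (k * (c * (b - a)))%C)
        by (unfold Re; simpl; ring).
      apply (is_derive_minus (fun t => Re (k * f (p t))%C) (fun t => t * Re (k * (c * (b - a)))%C)).
      + apply (is_derive_ext (fun u : R => Re (k *
          f (Re a + u * (Re b - Re a), Im a + u * (Im b - Im a))%R)%C)).
        { intros u. now rewrite Hp. }
        replace (b - a)%C with ((Re b - Re a, Im b - Im a)%R : C)
          by (apply injective_projections; unfold Re, Im; simpl; ring).
        apply (is_derive_scal_comp_complex k f).
        * rewrite <- Hp. now apply H.
        * auto_derive; trivial. ring.
        * auto_derive; trivial. ring.
      + generalize (Re (k * (c * (b - a)))%C). intros q. auto_derive; trivial. ring.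
    - replace (Re (k * (f b - f a - c * (b - a))))%C
        with (Re (k * ((f' (p t) - c) * (b - a)))%C).
      + eapply Rle_trans; [apply Re_le_Cmod|]. rewrite !Cmod_mult, Hk, Rmult_1_l.
        apply Rmult_le_compat_r; [apply Cmod_ge_0|]. apply H. lra.
      + replace (p 0) with a in Ht1 by (unfold p; ring).
        replace (p 1) with b in Ht1 by (unfold p; ring).
        rewrite Rminus_0_r, Rmult_1_r in Ht1. rewrite <- Ht1.
        unfold Re; simpl; ring. }
  eapply Rle_trans; [apply Cmod_le_abs|].
  assert (H1 := HK 1 Cmod_1).
  assert (H2 : Cmod (- Ci) = 1) by (rewrite Cmod_opp; apply Cmod_Ci).
  apply HK in H2. rewrite Cmult_1_l in H1.
  replace (Re (- Ci * (f b - f a - c * (b - a))))%C with (Im (f b - f a - c * (b - a))%C) in H2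
    by (unfold Re, Im; simpl; ring).
  lra.
Qed.

(** * The local inverse by a Newton iteration *)

Section Inverse.

Variables (f f' : C -> C) (z0 : C) (d : R).
Let c := f' z0.
Hypothesis c_neq_0 : c <> 0.
Hypothesis d_pos : 0 < d.
Hypothesis f_holo : C1_holomorphic (fun z => Cmod (z - z0) < d) f f'.
Hypothesis f'_close : forall z, Cmod (z - z0) < d -> Cmod (f' z - c) <= Cmod c / 4.

Let c_pos : 0 < Cmod c.
Proof. now apply Cmod_gt_0. Qed.

(** The quarter in [f'_close] is doubled by [Cmean_value]. The resulting |c|/2 makes the iteration
    below a contraction with factor 1/2. *)
Let lipschitz (a b : C) : Cmod (a - z0) < d -> Cmod (b - z0) < d ->
  Cmod (f b - f a - c * (b - a)) <= Cmod c / 2 * Cmod (b - a).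
Proof.
  intros Ha Hb. replace (Cmod c / 2) with (2 * (Cmod c / 4)) by field.
  apply (Cmean_value f f'). intros t Ht.
  assert (Hin : Cmod (a + t * (b - a) - z0) < d).
  { replace (a + t * (b - a) - z0)%C with (RtoC (1 - t) * (a - z0) + RtoC t * (b - z0))%C
      by (rewrite RtoC_minus; ring).
    eapply Rle_lt_trans; [apply Cmod_triangle|].
    rewrite !Cmod_mult, !Cmod_R, !Rabs_pos_eq by lra.
    generalize (Cmod_ge_0 (a - z0)) (Cmod_ge_0 (b - z0)). intros.
    destruct (Req_dec t 0); [subst; lra|]. nra. }
  split; [now apply f_holo|now apply f'_close].
Qed.

(** This gives injectivity of [f] on the disk and the Lipschitz constant 2/|c| of its inverse. *)
Let expansion (a b : C) : Cmod (a - z0) < d -> Cmod (b - z0) < d ->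
  Cmod c / 2 * Cmod (b - a) <= Cmod (f b - f a).
Proof.
  intros Ha Hb. assert (H := lipschitz a b Ha Hb).
  assert (H1 := Cmod_triangle (f b - f a) (- (f b - f a - c * (b - a)))).
  replace (f b - f a + - (f b - f a - c * (b - a)))%C with (c * (b - a))%C in H1 by ring.
  rewrite Cmod_opp, Cmod_mult in H1. lra.
Qed.

Let expansion_upper (a b : C) : Cmod (a - z0) < d -> Cmod (b - z0) < d ->
  Cmod (f b - f a) <= 2 * Cmod c * Cmod (b - a).
Proof.
  intros Ha Hb. assert (H := lipschitz a b Ha Hb).
  replace (f b - f a)%C with ((f b - f a - c * (b - a)) + c * (b - a))%C by ring.
  eapply Rle_trans; [apply Cmod_triangle|]. rewrite Cmod_mult.
  generalize (Cmod_ge_0 (b - a)). intros. nra.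
Qed.

(** Newton's method for f z = w with the derivative frozen at [z0]; its fixed points are the
    solutions. *)
Fixpoint newton (w : C) (n : nat) : C :=
  match n with O => z0 | S m => (newton w m + (w - f (newton w m)) / c)%C end.

(** The limit is taken with the total [Lim_seq], so it is meaningful only where the iteration
    converges; this is shown for w within |c| d / 4 of f z0. *)
Definition local_inverse (w : C) : C :=
  (real (Lim_seq (fun n => Re (newton w n))), real (Lim_seq (fun n => Im (newton w n)))).

(** The first step has length |w - f z0| / |c| < d/4 and each later one at most half of the
    preceding bound. The total stays below d/2, so the iterates remain where [lipschitz] applies,
    and both bounds are proved in one induction. *)
Let newton_step (w : C) (n : nat) : Cmod (w - f z0) < Cmod c * d / 4 ->
  Cmod (newton w n - z0) <= d / 2 * (1 - (1 / 2) ^ n) /\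
  Cmod (newton w (S n) - newton w n) <= d / 4 * (1 / 2) ^ n.
Proof.
  intros Hw.
  assert (Hpow : forall m, 0 < (1 / 2) ^ m) by (intros; apply pow_lt; lra).
  induction n.
  - split.
    + simpl. replace (z0 - z0)%C with (RtoC 0) by ring. rewrite Cmod_0. lra.
    + simpl. replace (z0 + (w - f z0) / c - z0)%C with ((w - f z0) / c)%C by ring.
      rewrite Cmod_div by auto. rewrite Rmult_1_r. left. apply Rlt_div_l; [exact c_pos|]. lra.
  - destruct IHn as [IH1 IH2].
    assert (H1 : Cmod (newton w (S n) - z0) <= d / 2 * (1 - (1 / 2) ^ S n)).
    { replace (newton w (S n) - z0)%C
        with ((newton w (S n) - newton w n) + (newton w n - z0))%C by ring.
      eapply Rle_trans; [apply Cmod_triangle|]. simpl pow in *. lra. }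
    split; auto.
    assert (L1 : Cmod (newton w n - z0) < d) by (specialize (Hpow n); nra).
    assert (L2 : Cmod (newton w (S n) - z0) < d) by (specialize (Hpow (S n)); nra).
    assert (HL := lipschitz _ _ L1 L2).
    assert (E : (newton w (S (S n)) - newton w (S n) =
      - (f (newton w (S n)) - f (newton w n) - c * (newton w (S n) - newton w n)) / c)%C).
    { change (newton w (S (S n)))
        with (newton w (S n) + (w - f (newton w (S n))) / c)%C.
      assert (E' : (w - f (newton w n) = c * (newton w (S n) - newton w n))%C)
        by (simpl; field; auto).
      replace w with (f (newton w n) + c * (newton w (S n) - newton w n))%C at 2
        by (rewrite <- E'; ring).
      field; auto. }
    rewrite E, Cmod_div, Cmod_opp by auto.
    apply Rle_div_l; [exact c_pos|]. simpl pow. nra.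
Qed.

Let newton_limit (w : C) : Cmod (w - f z0) < Cmod c * d / 4 ->
  is_lim_seq (fun n => Cmod (newton w n - local_inverse w)) 0.
Proof.
  intros Hw.
  assert (Hg : ex_series (fun n => d / 4 * (1 / 2) ^ n)).
  { apply (ex_series_scal_l (V := R_NormedModule) (d / 4) (fun n => (1 / 2) ^ n)).
    apply ex_series_geom. rewrite Rabs_pos_eq; lra. }
  assert (Hcv : forall u : nat -> R,
    (forall n, Rabs (u (S n) - u n) <= d / 4 * (1 / 2) ^ n) ->
    is_lim_seq u (real (Lim_seq u))).
  { intros u Hu. apply Lim_seq_correct'.
    assert (Hex : ex_series (fun n => u (S n) - u n))
      by (apply (ex_series_le (V := R_CompleteNormedModule) _ _ Hu Hg)).
    destruct Hex as [l Hl]. exists (l + u 0%nat). apply is_lim_seq_incr_1.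
    apply is_lim_seq_ext with (fun n => sum_n (fun n => u (S n) - u n) n + u 0%nat).
    - induction n; [rewrite sum_O; ring|]. rewrite sum_Sn.
      change (sum_n (fun n => u (S n) - u n) n + (u (S (S n)) - u (S n)) + u 0%nat = u (S (S n))).
      lra.
    - apply is_lim_seq_plus'; [exact Hl|apply is_lim_seq_const]. }
  assert (H1 : is_lim_seq (fun n => Re (newton w n)) (Re (local_inverse w))).
  { apply Hcv. intros n. eapply Rle_trans; [|apply (newton_step w n Hw)].
    apply (Re_le_Cmod (newton w (S n) - newton w n)). }
  assert (H2 : is_lim_seq (fun n => Im (newton w n)) (Im (local_inverse w))).
  { apply Hcv. intros n. eapply Rle_trans; [|apply (newton_step w n Hw)].
    apply (Im_le_Cmod (newton w (S n) - newton w n)). }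
  assert (G1 := is_lim_seq_minus' _ _ _ _ H1 (is_lim_seq_const (Re (local_inverse w)))).
  assert (G2 := is_lim_seq_minus' _ _ _ _ H2 (is_lim_seq_const (Im (local_inverse w)))).
  rewrite Rminus_diag in G1, G2. apply is_lim_seq_abs in G1, G2.
  simpl Rbar_abs in G1, G2. rewrite Rabs_R0 in G1, G2.
  assert (G := is_lim_seq_plus' _ _ _ _ G1 G2). rewrite Rplus_0_r in G.
  eapply is_lim_seq_le_le; [|apply is_lim_seq_const|apply G].
  intros n. split; [apply Cmod_ge_0|].
  apply (Cmod_le_abs (newton w n - local_inverse w)).
Qed.

(** The iterates stay within d/2, so their limit is strictly inside the disk. The residual w - f z_n
    equals c (z_(n+1) - z_n) and tends to 0, while [f] is Lipschitz. *)
Let local_inverse_spec (w : C) : Cmod (w - f z0) < Cmod c * d / 4 ->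
  Cmod (local_inverse w - z0) < d /\ f (local_inverse w) = w.
Proof.
  intros Hw. assert (HL := newton_limit w Hw).
  assert (Hpow : forall m, 0 < (1 / 2) ^ m) by (intros; apply pow_lt; lra).
  assert (Hin : forall n, Cmod (newton w n - z0) <= d / 2).
  { intros n. destruct (newton_step w n Hw) as [H _]. specialize (Hpow n). nra. }
  assert (H1 : Rbar_le (Cmod (local_inverse w - z0)) (0 + d / 2)).
  { apply (is_lim_seq_le (fun _ => Cmod (local_inverse w - z0))
      (fun n => Cmod (newton w n - local_inverse w) + d / 2) _ (0 + d / 2)).
    - intros n. specialize (Hin n).
      replace (local_inverse w - z0)%C
        with (- (newton w n - local_inverse w) + (newton w n - z0))%C by ring.
      eapply Rle_trans; [apply Cmod_triangle|]. rewrite Cmod_opp. lra.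
    - apply is_lim_seq_const.
    - apply is_lim_seq_plus'; [exact HL|apply is_lim_seq_const]. }
  simpl in H1.
  assert (H2 : Cmod (local_inverse w - z0) < d) by lra.
  split; auto.
  assert (H3 : Rbar_le (Cmod (f (local_inverse w) - w))
                 (2 * Cmod c * 0 + Cmod c * (d / 4) * 0)).
  { apply (is_lim_seq_le (fun _ => Cmod (f (local_inverse w) - w))
      (fun n => 2 * Cmod c * Cmod (newton w n - local_inverse w)
        + Cmod c * (d / 4) * (1 / 2) ^ n) _ (2 * Cmod c * 0 + Cmod c * (d / 4) * 0)).
    - intros n.
      assert (E' : (w - f (newton w n) = c * (newton w (S n) - newton w n))%C)
        by (simpl; field; auto).
      replace (f (local_inverse w) - w)%C
        with (- (f (newton w n) - f (local_inverse w)) + - (w - f (newton w n)))%C by ring.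
      eapply Rle_trans; [apply Cmod_triangle|]. rewrite !Cmod_opp. apply Rplus_le_compat.
      + apply expansion_upper; auto. specialize (Hin n). lra.
      + rewrite E', Cmod_mult, Rmult_assoc. apply Rmult_le_compat_l; [lra|].
        now apply newton_step.
    - apply is_lim_seq_const.
    - apply is_lim_seq_plus'.
      + apply (is_lim_seq_scal_l _ _ (Finite 0)). exact HL.
      + apply (is_lim_seq_scal_l _ _ (Finite 0)). apply is_lim_seq_geom.
        rewrite Rabs_pos_eq; lra. }
  simpl in H3.
  apply Ceq_minus, Cmod_eq_0. generalize (Cmod_ge_0 (f (local_inverse w) - w)). lra.
Qed.

(** Besides lying in the disk, points of [D'] must have their image in [E]; this makes [f] a
    bijection from [D'] to [E]. *)
Lemma inverse_function_ball :
  let D' := fun z => Cmod (z - z0) < d /\ Cmod (f z - f z0) < Cmod c * d / 4 in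
  let E := fun w => Cmod (w - f z0) < Cmod c * d / 4 in
  (forall z, D' z -> f' z <> 0 /\ local_inverse (f z) = z) /\
  (forall w, E w -> D' (local_inverse w) /\ f (local_inverse w) = w) /\
  C1_holomorphic E local_inverse (fun w => / f' (local_inverse w))%C.
Proof.
  intros D' E.
  assert (Hf'0 : forall z, Cmod (z - z0) < d -> f' z <> 0).
  { intros z Hz E0. assert (H := f'_close z Hz). rewrite E0 in H.
    replace (0 - c)%C with (- c)%C in H by ring. rewrite Cmod_opp in H. lra. }
  assert (HE : forall w, E w -> D' (local_inverse w) /\ f (local_inverse w) = w).
  { intros w Hw. destruct (local_inverse_spec w Hw) as [H1 H2]. repeat split; auto.
    now rewrite H2. }
  assert (Hderiv : forall w, E w ->
    complex_deriv local_inverse w (/ f' (local_inverse w))%C).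
  { intros w Hw.
    destruct (local_inverse_spec w Hw) as [H1 H2].
    assert (Hz := Hf'0 _ H1). assert (Hzm := Hz). apply Cmod_gt_0 in Hzm.
    destruct (f_holo _ H1) as [Hd _]. rewrite complex_deriv_iff in Hd |- *.
    intros eps.
    (* Of the two factors, |f'| compensates the division by f', and |c|/2 converts, through
       [expansion], the distance of the preimages into that of [v] and [w]. *)
    assert (He : 0 < eps * Cmod (f' (local_inverse w)) * (Cmod c / 2)).
    { apply Rmult_lt_0_compat; [apply Rmult_lt_0_compat; auto; apply cond_pos|lra]. }
    destruct (Hd (mkposreal _ He)) as [del Hdel]. simpl in Hdel.
    assert (Hw' := open_disk (f z0) (Cmod c * d / 4) w Hw).
    apply locally_Cmod in Hw'. destruct Hw' as [d1 Hd1].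
    assert (Hm : 0 < Rmin d1 (del * (Cmod c / 2))).
    { apply Rmin_glb_lt; [apply cond_pos|].
      apply Rmult_lt_0_compat; [apply cond_pos|lra]. }
    exists (mkposreal _ Hm). simpl. intros v Hv.
    assert (Hv1 := Rlt_le_trans _ _ _ Hv (Rmin_l _ _)).
    assert (Hv2 := Rlt_le_trans _ _ _ Hv (Rmin_r _ _)).
    destruct (local_inverse_spec v (Hd1 v Hv1)) as [H3 H4].
    assert (H5 := expansion _ _ H1 H3). rewrite H2, H4 in H5.
    assert (H6 : Cmod (local_inverse v - local_inverse w) < del).
    { apply Rmult_lt_reg_r with (Cmod c / 2); [lra|].
      eapply Rle_lt_trans; [|apply Hv2]. lra. }
    specialize (Hdel _ H6). rewrite H2, H4 in Hdel.
    replace (local_inverse v - local_inverse w - / f' (local_inverse w) * (v - w))%C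
      with (- (v - w - f' (local_inverse w) * (local_inverse v - local_inverse w))
            / f' (local_inverse w))%C by (field; auto).
    rewrite Cmod_div, Cmod_opp by auto. apply Rle_div_l; [exact Hzm|].
    eapply Rle_trans; [apply Hdel|].
    replace (eps * Cmod (v - w) * Cmod (f' (local_inverse w)))
      with (eps * Cmod (f' (local_inverse w)) * Cmod (v - w)) by ring.
    rewrite Rmult_assoc. apply Rmult_le_compat_l; [|exact H5].
    apply Rmult_le_pos; [left; apply cond_pos|lra]. }
  split; [|split; [exact HE|intros w Hw; split; [now apply Hderiv|]]].
  - intros z [H1 H2]. split; [now apply Hf'0|].
    destruct (local_inverse_spec (f z) H2) as [H3 H4].
    assert (H5 := expansion _ _ H1 H3). rewrite H4 in H5.
    replace (f z - f z)%C with (RtoC 0) in H5 by ring. rewrite Cmod_0 in H5.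
    assert (H6 : Cmod (local_inverse (f z) - z) = 0).
    { generalize (Cmod_ge_0 (local_inverse (f z) - z)). nra. }
    now apply Ceq_minus, Cmod_eq_0.
  - destruct (HE w Hw) as [[H1 _] _].
    apply continuous_Cinv; [|now apply Hf'0].
    apply (continuous_comp (U := C_UniformSpace) (V := C_UniformSpace) local_inverse f').
    + eapply complex_deriv_continuous. now apply Hderiv.
    + now apply f_holo.
Qed.

End Inverse.

(** * Partial derivatives in the plane and the Poincaré lemma *)

Lemma open_preimage {T S : UniformSpace} (f : T -> S) (D : T -> Prop) (E : S -> Prop) :
  open D -> open E -> (forall x, D x -> continuous f x) ->
  open (fun x => D x /\ E (f x)).
Proof.
  intros HD HE Hf x [Hx HEx]. apply filter_and; [now apply HD|].
  apply (Hf x Hx E). now apply HE.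
Qed.

Lemma inverse_function (D : C -> Prop) (f f' : C -> C) (z0 : C) :
  open (T := C_UniformSpace) D -> C1_holomorphic D f f' -> D z0 -> f' z0 <> 0 ->
  exists (D' E : C -> Prop) (k : C -> C),
    open (T := C_UniformSpace) D' /\ open (T := C_UniformSpace) E /\
    D' z0 /\ E (f z0) /\
    (forall z, D' z -> D z /\ f' z <> 0 /\ E (f z) /\ k (f z) = z) /\
    (forall w, E w -> D' (k w) /\ f (k w) = w) /\
    C1_holomorphic E k (fun w => / f' (k w))%C.
Proof.
  intros HD Hf Hz0 Hc.
  assert (Hc' := Hc). apply Cmod_gt_0 in Hc'.
  assert (H1 := HD z0 Hz0). apply locally_Cmod in H1. destruct H1 as [d1 H1].
  assert (H2 := proj2 (Hf z0 Hz0)). rewrite continuous_Cmod in H2.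
  (* Continuity of [f'] at [z0] supplies the disk on which the closeness hypothesis of
     [inverse_function_ball] holds. *)
  assert (He : 0 < Cmod (f' z0) / 4) by lra.
  destruct (H2 (mkposreal _ He)) as [d2 H3]. simpl in H3.
  set (d := Rmin d1 d2).
  assert (Hd : 0 < d) by (apply Rmin_glb_lt; apply cond_pos).
  assert (HdD : forall z, Cmod (z - z0) < d -> D z).
  { intros z Hz. apply H1. eapply Rlt_le_trans; [apply Hz|apply Rmin_l]. }
  assert (Hfd : C1_holomorphic (fun z => Cmod (z - z0) < d) f f') by (intros z Hz; auto).
  assert (Hclose : forall z, Cmod (z - z0) < d -> Cmod (f' z - f' z0) <= Cmod (f' z0) / 4).
  { intros z Hz. left. apply H3. eapply Rlt_le_trans; [apply Hz|apply Rmin_r]. }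
  destruct (inverse_function_ball f f' z0 d Hc Hd Hfd Hclose) as [I1 [I2 I3]].
  exists (fun z => Cmod (z - z0) < d /\ Cmod (f z - f z0) < Cmod (f' z0) * d / 4),
    (fun w => Cmod (w - f z0) < Cmod (f' z0) * d / 4), (local_inverse f f' z0).
  assert (Hzz : forall z : C, Cmod (z - z) = 0).
  { intros z. replace (z - z)%C with (RtoC 0) by ring. apply Cmod_0. }
  assert (Hr : 0 < Cmod (f' z0) * d / 4) by nra.
  split; [|split; [apply open_disk|split; [|split; [|split; [|split]]]]]; auto.
  - apply (open_preimage (T := C_UniformSpace) (S := C_UniformSpace) f
      (fun z => Cmod (z - z0) < d) (fun w => Cmod (w - f z0) < Cmod (f' z0) * d / 4)).
    + apply open_disk.
    + apply open_disk.
    + intros z Hz. eapply complex_deriv_continuous. now apply Hfd.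
  - now rewrite !Hzz.
  - now rewrite Hzz.
  - intros z Hz. destruct (I1 z Hz). destruct Hz as [Hz1 Hz2]. auto.
Qed.

Lemma dir_deriv_e1 (g : C_R_NormedModule -> R) (u v : R) :
  dir_deriv g ((u, v) : C_R_NormedModule) (1, 0) = Derive (fun s => g (s, v)) u.
Proof.
  unfold dir_deriv, Derive. f_equal. apply Lim_ext. intros h.
  assert (E : forall t : R, plus ((u, v) : C_R_NormedModule) (scal t ((1, 0) : C_R_NormedModule))
    = (u + t, v)).
  { intros t. apply injective_projections; simpl; unfold plus, scal; simpl; unfold mult; simpl; ring. }
  now rewrite !E, Rplus_0_l, Rplus_0_r.
Qed.

Lemma dir_deriv_e2 (g : C_R_NormedModule -> R) (u v : R) :
  dir_deriv g ((u, v) : C_R_NormedModule) (0, 1) = Derive (fun s => g (u, s)) v.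
Proof.
  unfold dir_deriv, Derive. f_equal. apply Lim_ext. intros h.
  assert (E : forall t : R, plus ((u, v) : C_R_NormedModule) (scal t ((0, 1) : C_R_NormedModule))
    = (u, v + t)).
  { intros t. apply injective_projections; simpl; unfold plus, scal; simpl; unfold mult; simpl; ring. }
  now rewrite !E, Rplus_0_l, Rplus_0_r.
Qed.

Section Plane.

Variable U : C_R_NormedModule -> Prop.
Hypothesis U_open : open U.

Lemma is_derive_e1 (g : C_R_NormedModule -> R) (u v : R) :
  Ck_on 1 U g -> U (u, v) ->
  is_derive (fun s => g (s, v)) u (dir_deriv g ((u, v) : C_R_NormedModule) (1, 0)).
Proof.
  intros Hg Huv.
  assert (H := is_derive_comp_C1 U g (fun s => s) (fun _ => v) u 1 0 U_open Hg Huv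
    (is_derive_id u) (is_derive_const v u)).
  now rewrite Rmult_1_l, Rmult_0_l, Rplus_0_r in H.
Qed.

Lemma is_derive_e2 (g : C_R_NormedModule -> R) (u v : R) :
  Ck_on 1 U g -> U (u, v) ->
  is_derive (fun s => g (u, s)) v (dir_deriv g ((u, v) : C_R_NormedModule) (0, 1)).
Proof.
  intros Hg Huv.
  assert (H := is_derive_comp_C1 U g (fun _ => u) (fun s => s) v 0 1 U_open Hg Huv
    (is_derive_const u v) (is_derive_id v)).
  now rewrite Rmult_1_l, Rmult_0_l, Rplus_0_l in H.
Qed.

Lemma continuity_2d_Ck (k : nat) (g : C_R_NormedModule -> R) (u v : R) :
  Ck_on k U g -> U (u, v) -> continuity_2d_pt (fun s t => g (s, t)) u v.
Proof.
  intros Hg Huv. apply continuity_2d_pt_filterlim.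
  change (continuous (T := C_R_NormedModule) (fun z => g (fst z, snd z)) (u, v)).
  apply (continuous_ext (T := C_R_NormedModule) g); [now intros [s t]|].
  apply (Ck_on_continuous k U g _ Hg Huv).
Qed.

(** Schwarz's theorem in terms of [dir_deriv]. It removes the second derivatives from the exterior
    derivatives computed in both directions of the equivalence. *)
Lemma dir_deriv_comm (g : C_R_NormedModule -> R) (z : C_R_NormedModule) :
  Ck_on 2 U g -> U z ->
  dir_deriv (fun y => dir_deriv g y (1, 0)) z (0, 1)
  = dir_deriv (fun y => dir_deriv g y (0, 1)) z (1, 0).
Proof.
  intros Hg Hz. destruct z as [a b].
  assert (Hg1 : Ck_on 1 U g) by now apply Ck_on_S.
  assert (G1 : Ck_on 1 U (fun y => dir_deriv g y (1, 0))) by apply Hg.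
  assert (G2 : Ck_on 1 U (fun y => dir_deriv g y (0, 1))) by apply Hg.
  assert (E1 : forall u v, Derive (fun t => g (t, v)) u = dir_deriv g ((u, v) : C_R_NormedModule) (1, 0))
    by (intros; now rewrite dir_deriv_e1).
  assert (E2 : forall u v, Derive (fun t => g (u, t)) v = dir_deriv g ((u, v) : C_R_NormedModule) (0, 1))
    by (intros; now rewrite dir_deriv_e2).
  assert (E21 : forall u v, Derive (fun z => Derive (fun t => g (z, t)) v) u =
    dir_deriv (fun y => dir_deriv g y (0, 1)) ((u, v) : C_R_NormedModule) (1, 0)).
  { intros u v. rewrite dir_deriv_e1. apply Derive_ext. intros; apply E2. }
  assert (E12 : forall u v, Derive (fun z => Derive (fun t => g (t, z)) u) v =
    dir_deriv (fun y => dir_deriv g y (1, 0)) ((u, v) : C_R_NormedModule) (0, 1)).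
  { intros u v. rewrite dir_deriv_e2. apply Derive_ext. intros; apply E1. }
  assert (HS := Schwarz (fun u v => g (u, v)) a b).
  rewrite E12, E21 in HS. symmetry. apply HS.
  - assert (HU := U_open (a, b) Hz). destruct HU as [eps Heps]. exists eps.
    intros u v Hu Hv.
    assert (Huv : U (u, v)) by (apply Heps; now split).
    repeat split.
    + eexists. now apply is_derive_e1.
    + eexists. now apply is_derive_e2.
    + apply (ex_derive_ext (fun z => dir_deriv g ((z, v) : C_R_NormedModule) (0, 1))); [intros; now rewrite E2|].
      eexists. now apply (is_derive_e1 (fun y => dir_deriv g y (0, 1))).
    + apply (ex_derive_ext (fun z => dir_deriv g ((u, z) : C_R_NormedModule) (1, 0))); [intros; now rewrite E1|].
      eexists. now apply (is_derive_e2 (fun y => dir_deriv g y (1, 0))).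
  - apply (continuity_2d_pt_ext (fun u v => dir_deriv (fun y => dir_deriv g y (0, 1)) ((u, v) : C_R_NormedModule) (1, 0))).
    + intros; now rewrite E21.
    + apply (continuity_2d_Ck 0 (fun z => dir_deriv (fun y => dir_deriv g y (0, 1)) z (1, 0))); auto.
      apply G2.
  - apply (continuity_2d_pt_ext (fun u v => dir_deriv (fun y => dir_deriv g y (1, 0)) ((u, v) : C_R_NormedModule) (0, 1))).
    + intros; now rewrite E12.
    + apply (continuity_2d_Ck 0 (fun z => dir_deriv (fun y => dir_deriv g y (1, 0)) z (0, 1))); auto.
      apply G1.
Qed.

(** Only derivatives along the axes are given. Continuity of [A] makes [f] differentiable as a
    function of two variables, so every directional derivative is a combination of [A] and [B], and
    these are C^k. *)
Lemma Ck_on_of_partials (k : nat) (f A B : C_R_NormedModule -> R) :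
  (forall u v, U (u, v) -> is_derive (fun s => f (s, v)) u (A (u, v))) ->
  (forall u v, U (u, v) -> is_derive (fun s => f (u, s)) v (B (u, v))) ->
  Ck_on k U A -> Ck_on k U B -> Ck_on (S k) U f.
Proof.
  intros H1 H2 HA HB.
  assert (HD : forall z : C_R_NormedModule, U z ->
    filterdiff (U := R2)
      (V := R_NormedModule) f (locally z) (fun h => fst h * A z + snd h * B z)).
  { intros [a b] Hz.
    assert (H := is_derive_filterdiff (fun u v => f (u, v)) a b (fun u v => A (u, v)) (B (a, b))).
    refine (filterdiff_ext_lin (FF := @filter_filter _ _ (locally_filter _)) _ _ _
      (filterdiff_ext (FF := @filter_filter _ _ (locally_filter _)) _ f _
       (fun p => f_equal f (eq_sym (surjective_pairing p))) (H _ _ _)) _).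
    - apply (locally_mono (T := C_R_NormedModule) U); [|now apply U_open].
      intros [u v] Huv. now apply H1.
    - now apply H2.
    - apply (continuous_ext (T := C_R_NormedModule) A); [now intros [u v]|].
      now apply (Ck_on_continuous k U A).
    - intros h. reflexivity. }
  apply (Ck_on_intro k U f (fun z h => fst h * A z + snd h * B z)); auto.
  - intros z Hz. apply (filterdiff_continuous (U := R2)
      (V := R_NormedModule)). eexists. now apply HD.
  - intros [a b] [p q] Hz.
    assert (L : forall x y : R, is_derive (fun t : R => x + t * y) 0 y).
    { intros x y. auto_derive; trivial. ring. }
    assert (H := filterdiff_comp'_2 (fun t : R => a + t * p) (fun t : R => b + t * q)
      (fun u v => f (u, v)) 0 _ _ (fun u v => u * A (a, b) + v * B (a, b)) (L a p) (L b q)).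
    cbv beta in H. rewrite !Rmult_0_l, !Rplus_0_r in H.
    eapply filterdiff_ext_lin; [apply H|].
    + apply (filterdiff_ext (U := R2)
       (V := R_NormedModule) (FF := @filter_filter _ _ (locally_filter _)) f _ _
       (fun z => f_equal f (surjective_pairing z))).
      now apply HD.
    + intros s. unfold scal; simpl; unfold mult; simpl. ring.
  - intros [p q]. apply Ck_on_plus; auto; apply Ck_on_mult; auto; now apply Ck_on_const.
Qed.

End Plane.

(** With a point, a disk contains the rectangle spanned by that point and the centre, hence the
    L-shaped path along which the primitive is integrated below. *)
Lemma disk_between (w0 : C) (rho u v s t : R) :
  Cmod ((u, v) - w0)%C < rho ->
  Rabs (s - Re w0) <= Rabs (u - Re w0) -> Rabs (t - Im w0) <= Rabs (v - Im w0) ->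
  Cmod ((s, t) - w0)%C < rho.
Proof.
  intros H Hs Ht. eapply Rle_lt_trans; [|apply H].
  unfold Cmod. apply sqrt_le_1_alt. simpl.
  rewrite !Rmult_1_r.
  apply Rplus_le_compat; apply Rsqr_le_abs_1; assumption.
Qed.

Lemma between_abs (a u t : R) : Rmin a u <= t <= Rmax a u -> Rabs (t - a) <= Rabs (u - a).
Proof.
  unfold Rmin, Rmax, Rabs. destruct (Rle_dec a u), (Rcase_abs _), (Rcase_abs _); lra.
Qed.

(** The primitive integrates [A] along the horizontal through [w0], then [B] along the vertical. Its
    v-derivative is immediate; the u-derivative is where closedness enters. The value [c] at the
    centre is left free in order to match base points later. *)
Lemma poincare_disk (w0 : C) (rho c : R) (A B : C_R_NormedModule -> R) :
  let D := (fun w : C_R_NormedModule => Cmod (w - w0) < rho) in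
  smooth_on D A -> smooth_on D B ->
  (forall w, D w -> dir_deriv A w (0, 1) = dir_deriv B w (1, 0)) ->
  exists f : C_R_NormedModule -> R, f w0 = c /\ smooth_on D f /\
    forall w h, D w -> dir_deriv f w h = fst h * A w + snd h * B w.
Proof.
  intros D HA HB Hcl.
  assert (HD : open D) by apply open_disk.
  set (f := fun w : C_R_NormedModule => c + (RInt (fun t => A (t, Im w0)) (Re w0) (fst w)
              + RInt (fun t => B (fst w, t)) (Im w0) (snd w))).
  assert (Hin1 : forall u v t, D (u, v) -> Rmin (Re w0) u <= t <= Rmax (Re w0) u -> D (t, Im w0)).
  { intros u v t Huv Ht. apply (disk_between w0 rho u v); auto using between_abs.
    replace (Im w0 - Im w0) with 0 by ring. rewrite Rabs_R0. apply Rabs_pos. }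
  assert (Hin2 : forall u v t, D (u, v) -> Rmin (Im w0) v <= t <= Rmax (Im w0) v -> D (u, t)).
  { intros u v t Huv Ht. apply (disk_between w0 rho u v); auto using between_abs. apply Rle_refl. }
  assert (Hcont1 : forall g u v, smooth_on D g -> D (u, v) -> continuous (fun t : R => g (t, v)) u).
  { intros g u v Hg Huv. apply continuous_of_ex_derive. eexists.
    apply (is_derive_e1 D HD g u v (Hg 1%nat) Huv). }
  assert (Hcont2 : forall g u v, smooth_on D g -> D (u, v) -> continuous (fun t : R => g (u, t)) v).
  { intros g u v Hg Huv. apply continuous_of_ex_derive. eexists.
    apply (is_derive_e2 D HD g u v (Hg 1%nat) Huv). }
  assert (HdB : smooth_on D (fun w => dir_deriv B w (1, 0))) by (intros k; apply (HB (S k))).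
  assert (Hloc1 : forall u v, D (u, v) -> locally u (fun s => D (s, v))).
  { intros u v Huv. destruct (HD _ Huv) as [eps Heps]. exists eps. intros s Hs.
    apply Heps. split; [exact Hs|apply ball_center]. }
  assert (Hloc2 : forall u v, D (u, v) -> locally v (fun s => D (u, s))).
  { intros u v Huv. destruct (HD _ Huv) as [eps Heps]. exists eps. intros s Hs.
    apply Heps. split; [apply ball_center|exact Hs]. }
  assert (Hex1 : forall u v, D (u, v) -> ex_RInt (fun t => A (t, Im w0)) (Re w0) u).
  { intros u v Huv. apply (ex_RInt_continuous (V := R_CompleteNormedModule)).
    intros t Ht. apply Hcont1; auto. apply (Hin1 u v); auto. }
  assert (Hex2 : forall u v, D (u, v) -> ex_RInt (fun t => B (u, t)) (Im w0) v).
  { intros u v Huv. apply (ex_RInt_continuous (V := R_CompleteNormedModule)).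
    intros t Ht. apply Hcont2; auto. apply (Hin2 u v); auto. }
  assert (Hdv : forall u v, D (u, v) -> is_derive (fun s => f (u, s)) v (B (u, v))).
  { intros u v Huv. unfold f. cbn [fst snd].
    rewrite <- (Rplus_0_l (B (u, v))).
    apply (is_derive_plus (fun _ => c)); [apply (is_derive_const c)|].
    rewrite <- (Rplus_0_l (B (u, v))).
    apply (is_derive_plus (fun _ => RInt (fun t => A (t, Im w0)) (Re w0) u));
      [apply (is_derive_const (V := R_NormedModule))|].
    apply (is_derive_RInt (V := R_NormedModule) (fun t => B (u, t)) _ (Im w0)).
    - apply (filter_imp (fun s => D (u, s))); [|now apply Hloc2].
      intros s Hs. apply (RInt_correct (V := R_CompleteNormedModule)). now apply Hex2.
    - now apply Hcont2. }
  assert (Hdu : forall u v, D (u, v) -> is_derive (fun s => f (s, v)) u (A (u, v))).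
  { intros u v Huv. unfold f. cbn [fst snd].
    rewrite <- (Rplus_0_l (A (u, v))).
    apply (is_derive_plus (fun _ => c)); [apply (is_derive_const c)|].
    (* Differentiation under the integral sign produces the integral of B_u, which equals A_v by
       closedness and so integrates to A (u, v) - A (u, Im w0). *)
    replace (A (u, v)) with (A (u, Im w0)
      + RInt (fun t => Derive (fun s => B (s, t)) u) (Im w0) v).
    - apply (is_derive_plus (fun s => RInt (fun t => A (t, Im w0)) (Re w0) s)
        (fun s => RInt (fun t => B (s, t)) (Im w0) v)).
      + apply (is_derive_RInt (V := R_NormedModule) (fun t => A (t, Im w0)) _ (Re w0)).
        * apply (filter_imp (fun s => D (s, v))); [|now apply Hloc1].
          intros s Hs. apply (RInt_correct (V := R_CompleteNormedModule)). now apply (Hex1 s v).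
        * apply Hcont1; auto. apply (Hin1 u v); auto. split; [apply Rmin_r|apply Rmax_r].
      + apply (is_derive_RInt_param (fun s t => B (s, t))).
        * apply (filter_imp (fun s => D (s, v))); [|now apply Hloc1].
          intros s Hs t Ht. eexists. apply (is_derive_e1 D HD B s t (HB 1%nat)).
          now apply (Hin2 s v).
        * intros t Ht.
          apply (continuity_2d_pt_ext (fun s t => dir_deriv B ((s, t) : C_R_NormedModule) (1, 0))).
          { intros. apply dir_deriv_e1. }
          apply (continuity_2d_Ck D 0 (fun w => dir_deriv B w (1, 0))); [apply HdB|].
          now apply (Hin2 u v).
        * apply (filter_imp (fun s => D (s, v))); [|now apply Hloc1].
          intros s Hs. now apply Hex2.
    - assert (HR : is_RInt (fun t => Derive (fun s => B (s, t)) u) (Im w0) v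
        (minus (A (u, v)) (A (u, Im w0)))).
      { apply (is_RInt_derive (V := R_CompleteNormedModule) (fun t => A (u, t))).
        - intros t Ht. rewrite <- (dir_deriv_e1 B), <- Hcl by now apply (Hin2 u v).
          apply (is_derive_e2 D HD A u t (HA 1%nat)). now apply (Hin2 u v).
        - intros t Ht. apply (continuous_ext (fun t => dir_deriv B ((u, t) : C_R_NormedModule) (1, 0))).
          { intros; apply dir_deriv_e1. }
          apply (Hcont2 (fun w => dir_deriv B w (1, 0))); auto. now apply (Hin2 u v). }
      apply (is_RInt_unique (V := R_CompleteNormedModule)) in HR. rewrite HR.
      unfold minus, plus, opp; simpl. ring. }
  assert (Hf : smooth_on D f).
  { intros [|k].
    - apply Ck_on_S. now apply (Ck_on_of_partials D HD 0 f A B).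
    - now apply (Ck_on_of_partials D HD k f A B). }
  exists f. split; [|split; [exact Hf|]].
  - unfold f. change (fst w0) with (Re w0). change (snd w0) with (Im w0).
    rewrite !RInt_point. unfold zero; simpl. ring.
  - intros [u v] h Hw. rewrite (dir_deriv_partials D f _ h HD (Hf 1%nat) Hw).
    rewrite dir_deriv_e1, dir_deriv_e2.
    f_equal; f_equal; apply is_derive_unique; auto.
Qed.

(** * Contact isometries *)

Lemma open_base (U : R3 -> Prop) : open U -> open (T := C_R_NormedModule) (base U).
Proof.
  intros HU z [x [Hx Hz]]. destruct (HU x Hx) as [eps Heps]. exists eps.
  intros z' Hz'. exists (rc x, z'). split; auto.
  apply Heps. split; [apply ball_center|]. change (ball (zc x) eps z'). now rewrite Hz.
Qed.

Lemma slice_line (r : R) (z h : C_R_NormedModule) (t : R) :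
  plus ((r, z) : R3) (scal t ((0, h) : R3)) = (r, plus z (scal t h)).
Proof.
  apply injective_projections; [|reflexivity].
  simpl. unfold plus, scal; simpl; unfold mult; simpl. ring.
Qed.

Lemma dir_deriv_slice (g : R3 -> R) (r : R) (z h : C_R_NormedModule) :
  dir_deriv (fun w : C_R_NormedModule => g (r, w)) z h = dir_deriv g ((r, z) : R3) ((0, h) : R3).
Proof. apply Derive_ext. intros t. now rewrite slice_line. Qed.

Lemma open_slice (N : R3 -> Prop) (r : R) :
  open N -> open (fun z : C_R_NormedModule => N (r, z)).
Proof.
  intros HN z Hz. destruct (HN _ Hz) as [eps Heps]. exists eps. intros z' Hz'.
  apply Heps. split; [apply ball_center|exact Hz'].
Qed.

Lemma Ck_on_slice (k : nat) (N : R3 -> Prop) (g : R3 -> R) (r : R) :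
  open N -> Ck_on k N g ->
  Ck_on k (fun z : C_R_NormedModule => N (r, z)) (fun z : C_R_NormedModule => g (r, z)).
Proof.
  intros HN. revert g. induction k; intros g Hg.
  1: split; auto.
  2: apply (Ck_on_intro k _ _ (fun z h => dir_deriv g ((r, z) : R3) ((0, h) : R3)));
     [now apply open_slice| | |].
  1, 2: intros z Hz; apply (continuous_comp (V := R3) (fun w : C_R_NormedModule => (r, w)) g);
    [ intros P [eps HP]; exists eps; intros z' Hz'; apply HP; split; [apply ball_center|exact Hz']
    | eapply Ck_on_continuous; eauto ].
  - intros z h Hz. apply (is_derive_ext (fun t : R => g (plus ((r, z) : R3) (scal t ((0, h) : R3))))).
    { intros t. now rewrite slice_line. }
    now apply (Ck_on_is_derive k N).
  - intros h. apply (IHk (fun x => dir_deriv g x ((0, h) : R3))). apply Hg.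
Qed.

Lemma continuous_R3 (phi : R3 -> R3) (x : R3) :
  continuous (fun y => rc (phi y)) x -> continuous (fun y => uc (phi y)) x ->
  continuous (fun y => vc (phi y)) x -> continuous phi x.
Proof.
  intros H1 H2 H3.
  assert (H4 : continuous (U := C_UniformSpace) (fun y => zc (phi y)) x)
    by now apply continuous_C_pair.
  intros P [eps HP].
  assert (A1 : locally x (fun y => ball (rc (phi x)) eps (rc (phi y))))
    by exact (H1 _ (locally_ball (rc (phi x)) eps)).
  assert (A2 : locally x (fun y => ball (zc (phi x) : C_UniformSpace) eps (zc (phi y))))
    by exact (H4 _ (locally_ball (zc (phi x) : C_UniformSpace) eps)).
  refine (locally_mono _ (fun y => P (phi y)) x _ (filter_and _ _ A1 A2)).
  intros y [Hy1 Hy2]. apply HP. now split.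
Qed.

Lemma Cmod_sqr (z : C) : Cmod z ^ 2 = Re z ^ 2 + Im z ^ 2.
Proof.
  unfold Cmod. rewrite pow2_sqrt; [reflexivity|].
  apply Rplus_le_le_0_compat; apply pow2_ge_0.
Qed.

Lemma conformal_factor_iff (a b : R) (d : C) :
  (RtoC a * d * Cconj d)%C = RtoC b <-> a * (Re d ^ 2 + Im d ^ 2) = b.
Proof.
  assert (E : (RtoC a * d * Cconj d)%C = RtoC (a * (Re d ^ 2 + Im d ^ 2))).
  { destruct d as [p q]. apply injective_projections; simpl; ring. }
  rewrite E. split; [apply RtoC_inj|congruence].
Qed.

Lemma sasakian_F_v (U : R3 -> Prop) (P0 F : C -> R) (z : C) :
  sasakian_data U P0 F -> base U z ->
  dir_deriv (V := C_R_NormedModule) F z (0, 1) = 1 / P0 z ^ 2.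
Proof.
  intros [_ [_ [_ [_ HF]]]] Hz. destruct z as [u v].
  rewrite (dir_deriv_e2 F). apply is_derive_unique. now apply HF.
Qed.

Lemma Cauchy_Riemann_complex_deriv (S : C_R_NormedModule -> Prop) (X Y : C_R_NormedModule -> R)
    (z : C_R_NormedModule) :
  open S -> Ck_on 1 S X -> Ck_on 1 S Y -> S z ->
  dir_deriv X z (1, 0) = dir_deriv Y z (0, 1) ->
  dir_deriv X z (0, 1) = - dir_deriv Y z (1, 0) ->
  complex_deriv (fun w => (X w, Y w)) z (dir_deriv X z (1, 0), dir_deriv Y z (1, 0)).
Proof.
  intros HS HX HY Hz CR1 CR2. apply complex_deriv_filterdiff. simpl. split.
  - rewrite <- CR2. now apply (C1_filterdiff S).
  - rewrite CR1. now apply (C1_filterdiff S).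
Qed.

(* On the slice [r = const], [RR], [X], [Y] are the components of a contact
   isometry. The exterior derivative of [dR + Ft dX = F du] prescribes the
   Jacobian of [(X, Y)], the metric prescribes [X_u^2 + Y_u^2] and
   [X_v^2 + Y_v^2]; so [(X_u - Y_v)^2 + (X_v + Y_u)^2 = 0]. *)
Lemma contact_isometry_Cauchy_Riemann (S T : C_R_NormedModule -> Prop)
    (P F Pt Ft RR X Y : C_R_NormedModule -> R) (z : C_R_NormedModule) :
  open S -> open T -> (forall w, S w -> T (X w, Y w)) ->
  Ck_on 2 S RR -> Ck_on 2 S X -> Ck_on 1 S Y -> Ck_on 1 S F -> Ck_on 1 T Ft ->
  (forall w, S w -> P w <> 0) -> (forall w, T w -> Pt w <> 0) ->
  (forall w, S w -> dir_deriv F w (0, 1) = 1 / P w ^ 2) ->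
  (forall w, T w -> dir_deriv Ft w (0, 1) = 1 / Pt w ^ 2) ->
  (forall w h, S w -> dir_deriv RR w h + Ft (X w, Y w) * dir_deriv X w h = F w * fst h) ->
  (forall w h, S w -> 1 / (2 * Pt (X w, Y w) ^ 2) * (dir_deriv X w h ^ 2 + dir_deriv Y w h ^ 2)
     = 1 / (2 * P w ^ 2) * (fst h ^ 2 + snd h ^ 2)) ->
  S z ->
  dir_deriv X z (1, 0) = dir_deriv Y z (0, 1) /\
  dir_deriv X z (0, 1) = - dir_deriv Y z (1, 0) /\
  P z ^ 2 * (dir_deriv X z (1, 0) ^ 2 + dir_deriv Y z (1, 0) ^ 2) = Pt (X z, Y z) ^ 2.
Proof.
  intros HS HT HST HR HX HY HF HFt HP HPt HFv HFtv Hform Hmetric Hz.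
  assert (HX1 : Ck_on 1 S X) by now apply Ck_on_S.
  assert (HXu : Ck_on 1 S (fun w => dir_deriv X w (1, 0))) by apply HX.
  assert (HXv : Ck_on 1 S (fun w => dir_deriv X w (0, 1))) by apply HX.
  assert (HRu : Ck_on 1 S (fun w => dir_deriv RR w (1, 0))) by apply HR.
  assert (HRv : Ck_on 1 S (fun w => dir_deriv RR w (0, 1))) by apply HR.
  assert (HG : Ck_on 1 S (fun w => Ft (X w, Y w))) by now apply (Ck_on_comp 1 S T Ft X Y).
  (* The form identity in direction [a] is differentiated along [b]. Subtracting the two cases that
     exchange the axes is the exterior derivative: the mixed derivatives of [RR] and [X] cancel, as
     do the terms with the first partial of [Ft], and the Jacobian remains. *)
  assert (Hdiff : forall a b, Ck_on 1 S (fun w => dir_deriv RR w a) ->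
    Ck_on 1 S (fun w => dir_deriv X w a) ->
    dir_deriv (fun w => dir_deriv RR w a) z b
    + (dir_deriv (fun w => Ft (X w, Y w)) z b * dir_deriv X z a
       + Ft (X z, Y z) * dir_deriv (fun w => dir_deriv X w a) z b)
    = dir_deriv F z b * fst a).
  { intros a b H1 H2.
    transitivity (dir_deriv (fun w => F w * fst a) z b).
    - transitivity (dir_deriv (fun w => dir_deriv RR w a + Ft (X w, Y w) * dir_deriv X w a) z b).
      + symmetry. apply is_derive_unique.
        apply (is_derive_plus (V := R_NormedModule)); [now apply (Ck_on_is_derive 0 S)|].
        generalize (is_derive_mult
          (fun t : R => (fun w => Ft (X w, Y w)) (plus z (scal t b)))
          (fun t : R => (fun w => dir_deriv X w a) (plus z (scal t b))) 0 _ _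
          (Ck_on_is_derive 0 S _ z b HG Hz) (Ck_on_is_derive 0 S _ z b H2 Hz) Rmult_comm).
        cbv beta. rewrite line_at_0. intros H; exact H.
      + apply (dir_deriv_ext_on S); auto.
    - apply is_derive_unique.
      apply (is_derive_ext (fun t : R => fst a * F (plus z (scal t b)))).
      { intros t. apply Rmult_comm. }
      rewrite Rmult_comm. apply (is_derive_scal (fun t : R => F (plus z (scal t b)))).
      now apply (Ck_on_is_derive 0 S). }
  assert (Hcomp : forall b, dir_deriv (fun w => Ft (X w, Y w)) z b
    = dir_deriv X z b * dir_deriv Ft (X z, Y z) (1, 0)
      + dir_deriv Y z b * dir_deriv Ft (X z, Y z) (0, 1)).
  { intros b. apply is_derive_unique.
    generalize (is_derive_comp_C1 T Ft (fun t : R => X (plus z (scal t b)))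
      (fun t : R => Y (plus z (scal t b))) 0 (dir_deriv X z b) (dir_deriv Y z b) HT HFt).
    rewrite line_at_0. intros H.
    apply H; [now apply HST|now apply (Ck_on_is_derive 0 S)|now apply (Ck_on_is_derive 0 S)]. }
  assert (E1 := Hdiff (1, 0) (0, 1) HRu HXu).
  assert (E2 := Hdiff (0, 1) (1, 0) HRv HXv).
  rewrite (dir_deriv_comm S HS RR z HR Hz), (dir_deriv_comm S HS X z HX Hz) in E1.
  rewrite Hcomp, HFtv in E1, E2 by now apply HST.
  rewrite HFv in E1 by auto. simpl fst in E1, E2.
  assert (M1 := Hmetric z (1, 0) Hz). assert (M2 := Hmetric z (0, 1) Hz).
  simpl fst in M1, M2. simpl snd in M1, M2.
  assert (N1 : P z ^ 2 <> 0) by now apply pow_nonzero, HP.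
  assert (N2 : Pt (X z, Y z) ^ 2 <> 0) by now apply pow_nonzero, HPt, HST.
  set (p := P z ^ 2) in *. set (q := Pt (X z, Y z) ^ 2) in *.
  set (xu := dir_deriv X z (1, 0)) in *. set (xv := dir_deriv X z (0, 1)) in *.
  set (yu := dir_deriv Y z (1, 0)) in *. set (yv := dir_deriv Y z (0, 1)) in *.
  assert (J : (xu * yv - xv * yu) / q = 1 / p).
  { unfold Rdiv in *. lra. }
  assert (J' : xu * yv - xv * yu = q / p).
  { transitivity ((xu * yv - xv * yu) / q * q); [now field|]. rewrite J. now field. }
  assert (M1' : xu ^ 2 + yu ^ 2 = q / p).
  { transitivity (1 / (2 * q) * (xu ^ 2 + yu ^ 2) * (2 * q)); [now field|]. rewrite M1. now field. }
  assert (M2' : xv ^ 2 + yv ^ 2 = q / p).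
  { transitivity (1 / (2 * q) * (xv ^ 2 + yv ^ 2) * (2 * q)); [now field|]. rewrite M2. now field. }
  (* The left side expands to the sum of the left sides of [M1'] and [M2'] minus twice that of
     [J']. *)
  assert (Hsq : (xu - yv) ^ 2 + (xv + yu) ^ 2 = 0) by nra.
  assert (Z : xu - yv = 0 /\ xv + yu = 0).
  { generalize (pow2_ge_0 (xu - yv)) (pow2_ge_0 (xv + yu)). intros.
    split; apply Rsqr_0_uniq; rewrite Rsqr_pow2; lra. }
  split; [lra|split; [lra|]]. rewrite M1'. now field.
Qed.

(** * From a contact isometry to an analytic function *)

Lemma analytic_of_contact_isometric (U Ut : R3 -> Prop) (P0 F P0t Ft : C -> R) (p pt : R3) :
  sasakian_data U P0 F -> sasakian_data Ut P0t Ft ->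
  locally_contact_isometric (sasakian_chart U P0 F) (sasakian_chart Ut P0t Ft) p pt ->
  exists (W : C -> Prop) (z : C -> C),
    open W /\ W (zc pt) /\ z (zc pt) = zc p /\
    (forall w, W w -> base Ut w /\ base U (z w)) /\
    analytic_on W z /\
    (forall w, W w ->
       exists dz : C,
         complex_deriv z w dz /\
         (RtoC (P0t w ^ 2)%R * dz * Cconj dz)%C = RtoC (P0 (z w) ^ 2)%R).
Proof.
  intros HD HDt [N1 [N2 [phi [HN1 [HN2 [Hp [Hpt [HN1U [HN2U [Hphi [Hdiff [Hmet Hform]]]]]]]]]]]].
  destruct Hdiff as [psi [Hpsi1 [_ [[Hs1 [Hs2 Hs3]] _]]]].
  simpl in HN1U, HN2U.
  set (r := rc p).
  set (S := fun z : C_R_NormedModule => N1 (r, z)).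
  set (RR := fun z : C_R_NormedModule => rc (phi (r, z))).
  set (X := fun z : C_R_NormedModule => uc (phi (r, z))).
  set (Y := fun z : C_R_NormedModule => vc (phi (r, z))).
  assert (HS : open S) by now apply open_slice.
  assert (HRk : forall k, Ck_on k S RR) by (intros k; apply (Ck_on_slice k N1 (fun x => rc (phi x))); auto).
  assert (HXk : forall k, Ck_on k S X) by (intros k; apply (Ck_on_slice k N1 (fun x => uc (phi x))); auto).
  assert (HYk : forall k, Ck_on k S Y) by (intros k; apply (Ck_on_slice k N1 (fun x => vc (phi x))); auto).
  assert (HSU : forall z, S z -> base U z) by (intros z Hz; exists (r, z); auto).
  assert (HXY : forall z, (X z, Y z) = zc (phi (r, z))) by (intros z; apply Ceta).
  assert (HST : forall z, S z -> base Ut (X z, Y z)).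
  { intros z Hz. rewrite HXY. exists (phi (r, z)). split; auto. apply HN2U. now apply Hpsi1. }
  assert (HF : sasakian_data U P0 F) by auto. assert (HFt : sasakian_data Ut P0t Ft) by auto.
  destruct HD as [HU [_ [HFs [HP _]]]], HDt as [HUt [_ [HFts [HPt _]]]].
  assert (Hform' : forall z h, S z ->
    dir_deriv RR z h + Ft (X z, Y z) * dir_deriv X z h = F z * fst h).
  { intros z h Hz. generalize (Hform (r, z) (0, h) Hz).
    unfold RR, X, Y. rewrite (dir_deriv_slice (fun x => rc (phi x))),
      (dir_deriv_slice (fun x => uc (phi x))).
    unfold pullback_form, differential.
    simpl. unfold sasakian_form, rc, uc, vc, zc, Re, Im. simpl.
    rewrite <- surjective_pairing. intros E. rewrite E. ring. }
  assert (HCR : forall z, S z ->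
    dir_deriv X z (1, 0) = dir_deriv Y z (0, 1) /\
    dir_deriv X z (0, 1) = - dir_deriv Y z (1, 0) /\
    P0 z ^ 2 * (dir_deriv X z (1, 0) ^ 2 + dir_deriv Y z (1, 0) ^ 2) = P0t (X z, Y z) ^ 2).
  { intros z Hz.
    apply (contact_isometry_Cauchy_Riemann S (base Ut) P0 F P0t Ft RR X Y z); auto.
    - now apply open_base.
    - apply (Ck_on_sub 1 (base U)); auto.
    - intros w Hw. apply (sasakian_F_v U); auto.
    - intros w Hw. apply (sasakian_F_v Ut); auto.
    - intros w h Hw.
      (* On equal arguments the metric is the square of the form plus the horizontal part; the form
         being preserved, the horizontal part is preserved as well. *)
      generalize (Hmet (r, w) (0, h) (0, h) Hw) (Hform (r, w) (0, h) Hw).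
      unfold X, Y. rewrite (dir_deriv_slice (fun x => uc (phi x))),
        (dir_deriv_slice (fun x => vc (phi x))).
      unfold pullback_metric, pullback_form, differential.
      simpl. unfold sasakian_metric. intros E1 E2. rewrite E2 in E1.
      unfold uc, vc, zc, Re, Im in *. simpl in *. rewrite <- surjective_pairing. lra. }
  set (f := fun z : C => (X z, Y z) : C).
  set (f' := fun z : C => (dir_deriv X z (1, 0), dir_deriv Y z (1, 0)) : C).
  assert (Hf : C1_holomorphic S f f').
  { intros z Hz. destruct (HCR z Hz) as [CR1 [CR2 _]]. split.
    - now apply (Cauchy_Riemann_complex_deriv S).
    - apply continuous_C_pair.
      + apply (Ck_on_continuous 0 S (fun z => dir_deriv X z (1, 0))); auto. apply (HXk 1%nat).
      + apply (Ck_on_continuous 0 S (fun z => dir_deriv Y z (1, 0))); auto. apply (HYk 1%nat). }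
  assert (Hp' : S (zc p)) by (unfold S, r, rc, zc; now rewrite <- surjective_pairing).
  assert (Hfp : f (zc p) = zc pt).
  { unfold f. rewrite HXY. rewrite <- Hphi. f_equal. f_equal.
    unfold r, rc, zc. symmetry; apply surjective_pairing. }
  (* A zero derivative would force [P0t] to vanish in the conformal identity of [HCR]. *)
  assert (Hf'0 : f' (zc p) <> 0).
  { intros E. destruct (HCR _ Hp') as [_ [_ E2]].
    unfold f' in E. injection E as Ea Eb. rewrite Ea, Eb in E2.
    apply (HPt _ (HST _ Hp')). simpl in E2. nra. }
  destruct (inverse_function S f f' (zc p) HS Hf Hp' Hf'0)
    as [D' [E [k [HD' [HE [HpD [HpE [HD'S [HEk Hk]]]]]]]]].
  rewrite Hfp in HpE.
  exists E, k.
  split; [exact HE|split; [exact HpE|split; [|split; [|split]]]].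
  - rewrite <- Hfp. now apply HD'S.
  - intros w Hw. destruct (HEk w Hw) as [H1 H2]. destruct (HD'S _ H1) as [H3 _].
    split; [rewrite <- H2; now apply HST|now apply HSU].
  - now apply (C1_holomorphic_analytic E k _ HE Hk).
  (* [HCR] gives the factor of the map z to w; its reciprocal is the factor of the inverse [k]. *)
  - intros w Hw. destruct (HEk w Hw) as [H1 H2]. destruct (HD'S _ H1) as [H3 [H4 _]].
    exists (/ f' (k w))%C. split; [now apply Hk|].
    apply conformal_factor_iff. rewrite <- !Cmod_sqr.
    destruct (HCR _ H3) as [_ [_ E3]].
    change (P0 (k w) ^ 2 * (Re (f' (k w)) ^ 2 + Im (f' (k w)) ^ 2) = P0t (f (k w)) ^ 2) in E3.
    rewrite H2, <- Cmod_sqr in E3. rewrite <- E3, Cmod_inv by auto.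
    field. apply Cmod_gt_0 in H4. lra.
Qed.

(** * From an analytic function to a contact isometry *)

Lemma dir_deriv_holomorphic (z : C -> C) (w d : C) (h : C_R_NormedModule) :
  complex_deriv z w d ->
  dir_deriv (V := C_R_NormedModule) (fun v => Re (z v)) w h = Re (d * h)%C /\
  dir_deriv (V := C_R_NormedModule) (fun v => Im (z v)) w h = Im (d * h)%C.
Proof.
  intros H. destruct (complex_deriv_line z w h d H). split; now apply is_derive_unique.
Qed.

(* [Ft du~ - F(z) d(Re z)] is closed: its exterior derivative compares the area
   forms [1 / Pt^2] and [|z'|^2 / P^2]. *)
Lemma fibre_shift (U Ut : R3 -> Prop) (P0 F P0t Ft : C -> R) (z z' : C -> C)
    (w0 : C) (rho c : R) :
  sasakian_data U P0 F -> sasakian_data Ut P0t Ft ->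
  let D := (fun w : C_R_NormedModule => Cmod (w - w0) < rho) in
  analytic_on D z -> C1_holomorphic D z z' ->
  (forall w, D w -> base Ut w /\ base U (z w)) ->
  (forall w, D w -> P0t w ^ 2 * (Re (z' w) ^ 2 + Im (z' w) ^ 2) = P0 (z w) ^ 2) ->
  exists f : C_R_NormedModule -> R, f w0 = c /\ smooth_on D f /\
    forall w h, D w -> dir_deriv f w h = Ft w * fst h - F (z w) * Re (z' w * h)%C.
Proof.
  intros HS HSt D Han Hz HDU Hconf.
  assert (HD : open D) by apply open_disk.
  destruct (analytic_smooth D z HD Han) as [HX HY].
  set (X := fun w : C_R_NormedModule => Re (z w)) in *.
  set (Y := fun w : C_R_NormedModule => Im (z w)) in *.
  assert (HdX : forall w h, D w -> dir_deriv X w h = Re (z' w * h)%C)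
    by (intros w h Hw; exact (proj1 (dir_deriv_holomorphic z w _ h (proj1 (Hz w Hw))))).
  assert (HdY : forall w h, D w -> dir_deriv Y w h = Im (z' w * h)%C)
    by (intros w h Hw; exact (proj2 (dir_deriv_holomorphic z w _ h (proj1 (Hz w Hw))))).
  assert (HU : open U) by apply HS. assert (HUt : open Ut) by apply HSt.
  assert (HF : smooth_on (V := C_R_NormedModule) (base U) F) by apply HS.
  assert (HFt : smooth_on (V := C_R_NormedModule) D Ft).
  { intros k. apply (Ck_on_sub k (base Ut)); [intros w Hw; now apply HDU|].
    apply (proj1 (proj2 (proj2 HSt)) k). }
  assert (HDb : forall w, D w -> base U (X w, Y w)).
  { intros w Hw. replace ((X w, Y w) : C) with (z w) by (symmetry; apply Ceta).
    now apply HDU. }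
  set (G := fun w : C_R_NormedModule => F (X w, Y w)).
  assert (HG : smooth_on D G).
  { intros k. apply (Ck_on_comp k D (base U) F X Y); auto. now apply open_base. }
  set (Xu := fun w : C_R_NormedModule => dir_deriv X w (1, 0)).
  set (Xv := fun w : C_R_NormedModule => dir_deriv X w (0, 1)).
  assert (HXu : smooth_on D Xu) by (intros k; apply (HX (S k))).
  assert (HXv : smooth_on D Xv) by (intros k; apply (HX (S k))).
  assert (Hneg : forall g, smooth_on D g -> smooth_on D (fun w => - 1 * g w)).
  { intros g Hg k. apply (Ck_on_mult k D (fun _ => -1)); auto. now apply Ck_on_const. }
  (* The two coefficients of the 1-form, using d(Re z) = X_u du~ + X_v dv~. Writing differences as
     sums with a factor -1 lets the closure lemmas apply. *)
  set (A := fun w : C_R_NormedModule => Ft w + -1 * (G w * Xu w)).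
  set (B := fun w : C_R_NormedModule => -1 * (G w * Xv w)).
  assert (HGX : smooth_on D (fun w => G w * Xu w)) by (intros k; apply Ck_on_mult; auto).
  assert (HGXv : smooth_on D (fun w => G w * Xv w)) by (intros k; apply Ck_on_mult; auto).
  assert (HA : smooth_on D A) by (intros k; apply Ck_on_plus; auto; apply Hneg; auto).
  assert (HB : smooth_on D B) by (apply Hneg; auto).
  destruct (poincare_disk w0 rho c A B HA HB) as [f [Hf0 [Hf Hdf]]].
  { intros w Hw.
    assert (Hcomp : forall b, dir_deriv G w b
      = dir_deriv X w b * dir_deriv (V := C_R_NormedModule) F (X w, Y w) (1, 0)
      + dir_deriv Y w b * dir_deriv (V := C_R_NormedModule) F (X w, Y w) (0, 1)).
    { intros b. apply is_derive_unique.
      generalize (is_derive_comp_C1 (base U) F (fun t : R => X (plus w (scal t b)))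
        (fun t : R => Y (plus w (scal t b))) 0 (dir_deriv X w b) (dir_deriv Y w b)
        (open_base U HU) (HF 1%nat)).
      rewrite line_at_0. intros H.
      apply H; [now apply HDb|now apply (Ck_on_is_derive 0 D)|now apply (Ck_on_is_derive 0 D)]. }
    assert (Hprod : forall g b, smooth_on D g ->
      is_derive (fun t : R => -1 * (G (plus w (scal t b)) * g (plus w (scal t b)))) 0
        (-1 * (dir_deriv G w b * g w + G w * dir_deriv g w b))).
    { intros g b Hg. apply (is_derive_scal (fun t : R => G (plus w (scal t b)) * g (plus w (scal t b)))).
      generalize (is_derive_mult (fun t : R => G (plus w (scal t b)))
        (fun t : R => g (plus w (scal t b))) 0 _ _
        (Ck_on_is_derive 0 D _ w b (HG 1%nat) Hw) (Ck_on_is_derive 0 D _ w b (Hg 1%nat) Hw) Rmult_comm).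
      rewrite line_at_0. intros H; exact H. }
    assert (EA : dir_deriv A w (0, 1) = dir_deriv (V := C_R_NormedModule) Ft w (0, 1)
      + -1 * (dir_deriv G w (0, 1) * Xu w + G w * dir_deriv Xu w (0, 1))).
    { apply is_derive_unique. apply (is_derive_plus (V := R_NormedModule)
        (fun t : R => Ft (plus (w : C_R_NormedModule) (scal t ((0, 1) : C_R_NormedModule))))).
      - now apply (Ck_on_is_derive 0 D Ft w (0, 1) (HFt 1%nat)).
      - now apply Hprod. }
    assert (EB : dir_deriv B w (1, 0)
      = -1 * (dir_deriv G w (1, 0) * Xv w + G w * dir_deriv Xv w (1, 0))).
    { apply is_derive_unique. now apply Hprod. }
    assert (EXX : dir_deriv Xu w (0, 1) = dir_deriv Xv w (1, 0))
      by (apply (dir_deriv_comm D HD X w (HX 2%nat) Hw)).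
    destruct (HDU w Hw) as [Hbt Hb].
    (* The terms with the mixed derivative of [X] and with the first partial of [F] cancel. What
       remains is 1/Pt^2 = |z'|^2 / P^2, the Jacobian of z being |z'|^2. *)
    rewrite EA, EB, EXX, !Hcomp, (sasakian_F_v Ut P0t Ft w HSt Hbt).
    rewrite (sasakian_F_v U P0 F (X w, Y w) HS (HDb w Hw)).
    unfold Xu, Xv. rewrite !HdX, !HdY by auto.
    replace ((X w, Y w) : C) with (z w) by (symmetry; apply Ceta).
    assert (Hc := Hconf w Hw).
    assert (Hp : P0 (z w) ^ 2 <> 0) by (apply pow_nonzero; now apply HS).
    assert (Hpt : P0t w ^ 2 <> 0) by (apply pow_nonzero; now apply HSt).
    set (q := P0 (z w) ^ 2) in *. set (s := P0t w ^ 2) in *.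
    set (g := G w * dir_deriv Xv w (1, 0)).
    set (F1 := dir_deriv _ _ _).
    destruct (z' w) as [a b]. simpl in Hc |- *.
    rewrite <- Hc in Hp |- *.
    assert (Hab : a * (a * 1) + b * (b * 1) <> 0) by (intros E; apply Hp; rewrite E; ring).
    field. split; [|auto]. intros E; apply Hab; rewrite <- E; ring. }
  exists f. split; [exact Hf0|split; [exact Hf|]].
  intros w [h1 h2] Hw. rewrite Hdf by exact Hw. unfold A, B, G, Xu, Xv.
  rewrite !HdX by auto.
  replace ((X w, Y w) : C) with (z w) by (symmetry; apply Ceta).
  destruct (z' w) as [a b]. simpl. ring.
Qed.

Lemma contact_isometric_of_analytic (U Ut : R3 -> Prop) (P0 F P0t Ft : C -> R) (p pt : R3)
    (W : C -> Prop) (z : C -> C) :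
  sasakian_data U P0 F -> sasakian_data Ut P0t Ft -> U p -> Ut pt ->
  open (T := C_UniformSpace) W -> W (zc pt) -> z (zc pt) = zc p ->
  (forall w, W w -> base Ut w /\ base U (z w)) ->
  analytic_on W z ->
  (forall w, W w ->
     exists dz : C,
       complex_deriv z w dz /\
       (RtoC (P0t w ^ 2)%R * dz * Cconj dz)%C = RtoC (P0 (z w) ^ 2)%R) ->
  locally_contact_isometric (sasakian_chart U P0 F) (sasakian_chart Ut P0t Ft) p pt.
Proof.
  intros HS HSt Hp Hpt HW Hw0 Hz0 HWU Han Hdz.
  assert (HU : open U) by apply HS. assert (HUt : open Ut) by apply HSt.
  set (w0 := zc pt) in *.
  set (z' := C_derive z).
  assert (Hz := analytic_C1_holomorphic W z HW Han). fold z' in Hz.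
  assert (Hconf : forall w, W w -> P0t w ^ 2 * (Re (z' w) ^ 2 + Im (z' w) ^ 2) = P0 (z w) ^ 2).
  { intros w Hw. destruct (Hdz w Hw) as [d [Hd Hd']].
    rewrite (complex_deriv_unique z w (z' w) d); [|now apply Hz|exact Hd].
    now apply conformal_factor_iff. }
  clearbody z'.
  assert (Hw0' := HW w0 Hw0). apply locally_Cmod in Hw0'. destruct Hw0' as [rho Hrho].
  set (D := fun w : C_R_NormedModule => Cmod (w - w0) < rho).
  assert (HD : open D) by apply open_disk.
  assert (HDW : forall w, D w -> W w) by exact Hrho.
  assert (HDw0 : D w0).
  { unfold D. replace (w0 - w0)%C with (RtoC 0) by ring. rewrite Cmod_0. apply cond_pos. }
  assert (HanD : analytic_on D z) by (intros w Hw; apply Han; auto).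
  assert (HzD : C1_holomorphic D z z') by (intros w Hw; apply Hz; auto).
  (* This value of the primitive at [w0] makes the shifted fibre coordinate of [pt] equal to that of
     [p]. *)
  destruct (fibre_shift U Ut P0 F P0t Ft z z' w0 rho (rc p - rc pt) HS HSt HanD HzD)
    as [f [Hf0 [Hf Hdf]]]; [intros; apply HWU; auto|intros; apply Hconf; auto|].
  fold D in Hf, Hdf.
  assert (Hz'0 : z' w0 <> 0).
  { intros E. assert (E2 := Hconf w0 Hw0). rewrite E in E2. simpl in E2.
    assert (HP : P0 (z w0) <> 0) by (apply HS; now apply HWU). apply HP. nra. }
  destruct (inverse_function D z z' w0 HD HzD HDw0 Hz'0)
    as [D' [E [k [HD' [HE [HDw [HEz [HD'D [HEk Hk]]]]]]]]].
  assert (Hkan := C1_holomorphic_analytic E k _ HE Hk).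
  destruct (analytic_smooth E k HE Hkan) as [HkX HkY].
  destruct (analytic_smooth D z HD HanD) as [HzX HzY].
  (* The isometry has to go from (r, z) to (r~, w), hence uses the inverse [k] of z(w); [psi] is the
     map written directly in terms of z(w). *)
  set (phi := fun x : R3 => (rc x - f (k (zc x)), k (zc x)) : R3).
  set (psi := fun y : R3 => (rc y + f (zc y), z (zc y)) : R3).
  (* Each set asks its points to lie in their own chart and to be mapped into the other one. The two
     conditions mirror each other, so [phi] and [psi] exchange [N1] and [N2]. *)
  set (N1 := fun x : R3 => (U x /\ E (zc x)) /\ Ut (phi x)).
  set (N2 := fun y : R3 => (Ut y /\ D' (zc y)) /\ U (psi y)).
  assert (HzcC : forall (O : C -> Prop) (V : R3 -> Prop), open V -> open (T := C_UniformSpace) O ->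
    open (fun x : R3 => V x /\ O (zc x))).
  { intros O V HV HO. apply open_and; auto.
    apply (open_comp (T := R3) (U := C_UniformSpace) (fun x => zc x) O); auto.
    intros x _. apply (continuous_snd (U := R_UniformSpace) (V := C_UniformSpace)). }
  assert (HO1 : open (fun x : R3 => U x /\ E (zc x))) by now apply HzcC.
  assert (HO2 : open (fun y : R3 => Ut y /\ D' (zc y))) by now apply HzcC.
  assert (Hcomp : forall (O : C_R_NormedModule -> Prop) (V : R3 -> Prop) (g : C_R_NormedModule -> R),
    open O -> open V -> (forall x, V x -> O (zc x)) -> smooth_on O g -> smooth_on V (fun x => g (zc x))).
  { intros O V g HO HV HVO Hg m.
    apply (Ck_on_ext m V (fun x => g (uc x, vc x))); auto.
    { intros x _. f_equal. apply Ceta. }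
    apply (Ck_on_comp m V O g uc vc); auto; try apply Ck_on_uc; try apply Ck_on_vc; auto.
    intros x Hx. replace ((uc x, vc x) : C) with (zc x) by (symmetry; apply Ceta). auto. }
  assert (Hfk : smooth_on E (fun w : C_R_NormedModule => f (k w))).
  { intros m. apply (Ck_on_ext m E (fun w => f (Re (k w), Im (k w)))); auto.
    { intros w _. f_equal. apply Ceta. }
    apply (Ck_on_comp m E D f (fun w => Re (k w)) (fun w => Im (k w))); auto.
    intros w Hw. rewrite Ceta. now apply HD'D, HEk. }
  assert (Hphi : smooth_map_on (fun x : R3 => U x /\ E (zc x)) phi).
  { split; [|split].
    - intros m.
      apply (Ck_on_ext m _ (fun x => rc x + -1 * f (k (zc x)))); auto.
      { intros x _. unfold phi, rc, zc. simpl. ring. }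
      apply Ck_on_plus; auto; [now apply Ck_on_rc|].
      apply Ck_on_mult; auto; [now apply Ck_on_const|].
      apply (Hcomp E _ (fun w => f (k w))); auto. intros x Hx; apply Hx.
    - apply (Hcomp E _ (fun w => Re (k w))); auto. intros x Hx; apply Hx.
    - apply (Hcomp E _ (fun w => Im (k w))); auto. intros x Hx; apply Hx. }
  assert (Hpsi : smooth_map_on (fun y : R3 => Ut y /\ D' (zc y)) psi).
  { split; [|split].
    - intros m.
      apply (Ck_on_plus m _ rc (fun y => f (zc y))); auto; [now apply Ck_on_rc|].
      apply (Hcomp D _ f); auto. intros x Hx; now apply HD'D.
    - apply (Hcomp D _ (fun w => Re (z w))); auto. intros x Hx; now apply HD'D.
    - apply (Hcomp D _ (fun w => Im (z w))); auto. intros x Hx; now apply HD'D. }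
  assert (Hcont : forall (V : R3 -> Prop) (g : R3 -> R3), smooth_map_on V g ->
    forall x, V x -> continuous g x).
  { intros V g [G1 [G2 G3]] x Hx.
    apply continuous_R3; [apply (Ck_on_continuous 0 V _ x (G1 0%nat) Hx)
      |apply (Ck_on_continuous 0 V _ x (G2 0%nat) Hx)
      |apply (Ck_on_continuous 0 V _ x (G3 0%nat) Hx)]. }
  assert (HN1 : open N1) by (apply (open_preimage (S := R3)); auto; now apply Hcont).
  assert (HN2 : open N2) by (apply (open_preimage (S := R3)); auto; now apply Hcont).
  assert (Hpsiphi : forall x, E (zc x) -> psi (phi x) = x).
  { intros x Hx. apply injective_projections.
    - change (rc x - f (k (zc x)) + f (k (zc x)) = rc x). ring.
    - now apply HEk. }
  assert (Hphipsi : forall y, D' (zc y) -> phi (psi y) = y).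
  { intros y Hy. destruct (HD'D _ Hy) as [_ [_ [_ Hkz]]].
    apply injective_projections.
    - change (rc y + f (zc y) - f (k (z (zc y))) = rc y). rewrite Hkz. ring.
    - exact Hkz. }
  assert (Hphip : phi p = pt).
  { assert (Hkp : k (zc p) = zc pt) by (rewrite <- Hz0; now apply HD'D).
    unfold phi. rewrite Hkp. fold w0. rewrite Hf0.
    apply injective_projections; unfold rc; simpl; [ring|reflexivity]. }
  assert (Hsmooth_sub : forall (V V' : R3 -> Prop) g, (forall x, V' x -> V x) ->
    smooth_map_on V g -> smooth_map_on V' g).
  { intros V V' g HV [G1 [G2 G3]]. split; [|split]; intros m; apply (Ck_on_sub m V); auto. }
  assert (HEp : E (zc p)) by (now rewrite <- Hz0).
  exists N1, N2, phi.
  split; [exact HN1|split; [exact HN2|split; [|split; [|split; [|split; [|split]]]]]].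
  - unfold N1. rewrite Hphip. auto.
  - unfold N2. rewrite <- Hphip, Hpsiphi by auto. rewrite Hphip. auto.
  - intros x Hx. apply Hx.
  - intros x Hx. apply Hx.
  - exact Hphip.
  (* Here [d] is the variation of w, and the variation of f (w) in direction [d] is given by [Hdf],
     where z' d is the horizontal part of [h]. The term with [Ft] is exactly what the contact form
     of the target cancels. *)
  - assert (Hdiff : forall x h, N1 x ->
      let d := (/ z' (k (zc x)) * zc h)%C in
      differential phi x h = (rc h - (Ft (k (zc x)) * Re d - F (zc x) * uc h), d) :> R3).
    { intros x h [[Hx HxE] _] d.
      destruct (HEk _ HxE) as [Hkx Hzk]. destruct (HD'D _ Hkx) as [HkD [Hz'k _]].
      destruct (complex_deriv_line k (zc x) (zc h) (/ z' (k (zc x)))%C (proj1 (Hk _ HxE))) as [L1 L2].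
      assert (EX : dir_deriv (fun y => uc (phi y)) x h = Re d) by exact (is_derive_unique _ _ _ L1).
      assert (EY : dir_deriv (fun y => vc (phi y)) x h = Im d) by exact (is_derive_unique _ _ _ L2).
      unfold differential. rewrite EX, EY.
      replace ((Re d, Im d) : C) with d by (symmetry; apply Ceta).
      f_equal. apply is_derive_unique.
      assert (L3 := is_derive_comp_C1 D f
        (fun t : R => Re (k (plus (zc x : C_R_NormedModule) (scal t (zc h : C_R_NormedModule)))))
        (fun t : R => Im (k (plus (zc x : C_R_NormedModule) (scal t (zc h : C_R_NormedModule)))))
        0 (Re d) (Im d) HD (Hf 1%nat)).
      cbv beta in L3. rewrite !line_at_0, Ceta in L3. specialize (L3 HkD L1 L2).
      change (is_derive (fun t : R => f
        (Re (k (plus (zc x : C_R_NormedModule) (scal t (zc h : C_R_NormedModule)))),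
         Im (k (plus (zc x : C_R_NormedModule) (scal t (zc h : C_R_NormedModule)))))) 0
        (fst d * dir_deriv f (k (zc x)) (1, 0) + snd d * dir_deriv f (k (zc x)) (0, 1))) in L3.
      rewrite <- (dir_deriv_partials D f (k (zc x)) d HD (Hf 1%nat) HkD) in L3.
      rewrite Hdf in L3 by exact HkD.
      replace (z' (k (zc x)) * d)%C with (zc h : C) in L3 by (unfold d; field; exact Hz'k).
      rewrite Hzk in L3.
      assert (L4 : is_derive (fun t : R => rc x + t * rc h) 0 (rc h)).
      { auto_derive; trivial. ring. }
      exact (is_derive_minus _ _ _ _ _ L4 (is_derive_ext _ _ _ _ (fun t => f_equal f (Ceta _)) L3)). }
    assert (Hform : forall x h, N1 x ->
      sasakian_form Ft (phi x) (differential phi x h) = sasakian_form F x h).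
    { intros x h Hx. rewrite Hdiff by auto. unfold sasakian_form, phi, rc, uc, zc, Re. simpl. ring. }
    split; [|split].
    + exists psi. split; [|split; [|split]].
      * intros x Hx. assert (HxE := proj2 (proj1 Hx)). split; [|now apply Hpsiphi].
        unfold N2. rewrite Hpsiphi by auto. split; [split|]; [apply Hx| |apply Hx].
        now apply HEk.
      * intros y Hy. assert (HyD := proj2 (proj1 Hy)). split; [|now apply Hphipsi].
        unfold N1. rewrite Hphipsi by auto. split; [split|]; [apply Hy| |apply Hy].
        now apply HD'D.
      * apply (Hsmooth_sub (fun x : R3 => U x /\ E (zc x))); auto. intros x Hx; apply Hx.
      * apply (Hsmooth_sub (fun y : R3 => Ut y /\ D' (zc y))); auto. intros x Hx; apply Hx.
    (* The squares of the forms agree by [Hform]. In the horizontal part the variations are divided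
       by z', and the factor 1/|z'|^2 this creates is absorbed by [Hconf]. *)
    + intros x h l Hx. unfold pullback_metric. simpl. unfold sasakian_metric.
      rewrite !Hform by auto. f_equal. rewrite !Hdiff by auto.
      destruct Hx as [[Hx HxE] _].
      destruct (HEk _ HxE) as [Hkx Hzk]. destruct (HD'D _ Hkx) as [HkD [Hz'k _]].
      assert (Hc := Hconf _ (HDW _ HkD)). rewrite Hzk in Hc. rewrite <- Hc.
      assert (HP : P0t (k (zc x)) <> 0) by (apply HSt, HWU; auto).
      assert (Hn : Re (z' (k (zc x))) ^ 2 + Im (z' (k (zc x))) ^ 2 <> 0).
      { rewrite <- Cmod_sqr. apply pow_nonzero. apply Cmod_gt_0 in Hz'k. lra. }
      unfold uc, vc. simpl. unfold phi. change (zc (rc x - f (k (zc x)), k (zc x))) with (k (zc x)).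
      revert Hn HP. generalize (P0t (k (zc x))) (z' (k (zc x))). intros s [a b] Hn HP.
      destruct h as [hr [hu hv]], l as [lr [lu lv]]. simpl in Hn |- *. field.
      split; [|exact HP]. intros E0; apply Hn; rewrite <- E0; ring.
    + intros x h Hx. now apply Hform.
Qed.

Theorem theorem4 :
  forall (U Ut : R3 -> Prop) (P0 F P0t Ft : C -> R),
    sasakian_data U P0 F ->
    sasakian_data Ut P0t Ft ->
    forall p pt : R3, U p -> Ut pt ->
      (locally_contact_isometric (sasakian_chart U P0 F)
         (sasakian_chart Ut P0t Ft) p pt
       <->
       exists (W : C -> Prop) (z : C -> C),
         open W /\ W (zc pt) /\ z (zc pt) = zc p /\
         (forall w, W w -> base Ut w /\ base U (z w)) /\
         analytic_on W z /\
         (forall w, W w ->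
            exists dz : C,
              complex_deriv z w dz /\
              (RtoC (P0t w ^ 2)%R * dz * Cconj dz)%C = RtoC (P0 (z w) ^ 2)%R)).
Proof.
  intros U Ut P0 F P0t Ft HS HSt p pt Hp Hpt. split.
  - now apply analytic_of_contact_isometric.
  - intros [W [z [HW [Hw0 [Hz0 [HWU [Han Hdz]]]]]]].
    now apply (contact_isometric_of_analytic U Ut P0 F P0t Ft p pt W z).
Qed.
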